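(* The Firefighter problem is fixed-parameter tractable with respect to the combined parameter pathwidth and maximum degree of the input graph: there is an algorithm that decides any instance $(G,s,b,k)$ in time $f(\mathrm{pw}(G),\Delta(G))\cdot n^{O(1)}$ for some computable function $f$, where $n$ is the instance size.
   Context: Firefighter process: given a graph $G=(V,E)$, a vertex $s\in V$ and a budget $b\in\mathbb{N}$, at step $t=0$ the vertex $s$ is burned. At every step $t>0$: (1) protection phase: at most $b$ vertices not yet burned become protected; (2) spreading phase: every unprotected vertex adjacent to a burned vertex becomes burned. Burned and protected vertices stay so; the process stops when no new vertex can become burned. The Firefighter problem: given $G$, $s\in V$ and positive integers $b,k$, decide whether there is a protection strategy with budget $b$ such that at most $k$ vertices are burned when the fire starts at $s$. $\mathrm{pw}(G)$ denotes pathwidth and $\Delta(G)$ maximum degree. *)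

(* Defs.v *)
From mathcomp Require Import all_boot.
Set Implicit Arguments.
Unset Strict Implicit.
Unset Printing Implicit Defensive.

Inductive move := MLeft | MRight | MStay.

Record TM := {
  tm_nQ : nat;
  tm_nS : nat;
  tm_delta : 'I_tm_nQ.+3 -> 'I_tm_nS.+3 -> 'I_tm_nQ.+3 * 'I_tm_nS.+3 * move
}.

Section TMs.
Variable M : TM.

Definition tstate := 'I_(tm_nQ M).+3.
Definition tsym := 'I_(tm_nS M).+3.

Definition blank : tsym := ord0.
Definition q_start : tstate := ord0.
Definition q_acc : tstate := inord 1.
Definition q_rej : tstate := inord 2.
Definition sym_of_bit (x : bool) : tsym := inord (nat_of_bool x).+1.

Record config := Config {
  c_state : tstate; c_left : seq tsym; c_cur : tsym; c_right : seq tsym }.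

Definition halted (c : config) : bool :=
  (c_state c == q_acc) || (c_state c == q_rej).

Definition step (c : config) : config :=
  if halted c then c else
  let: (q', a, m) := tm_delta (c_state c) (c_cur c) in
  match m with
  | MStay => Config q' (c_left c) a (c_right c)
  | MLeft => match c_left c with
             | [::] => Config q' [::] blank (a :: c_right c)
             | x :: l => Config q' l x (a :: c_right c)
             end
  | MRight => match c_right c with
              | [::] => Config q' (a :: c_left c) blank [::]
              | x :: r => Config q' (a :: c_left c) x r
              end
  end.

Definition init (w : seq bool) : config :=
  match map sym_of_bit w with
  | [::] => Config q_start [::] blank [::]
  | x :: r => Config q_start [::] x r
  end.

Definition run (t : nat) (w : seq bool) : config := iter t step (init w).

Fixpoint take_nonblank (s : seq tsym) : seq tsym :=
  match s with
  | [::] => [::]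
  | x :: r => if x == blank then [::] else x :: take_nonblank r
  end.

Definition output (c : config) : seq tsym := take_nonblank (c_cur c :: c_right c).

End TMs.

Fixpoint bits_aux (fuel m : nat) : seq bool :=
  match fuel with
  | 0 => [::]
  | fuel'.+1 => if m == 0 then [::] else odd m :: bits_aux fuel' m./2
  end.

Definition binary (m : nat) : seq bool := bits_aux m m.

(* self-delimiting code: each bit x becomes "1x", terminated by "00" *)
Definition encnat (m : nat) : seq bool :=
  flatten [seq [:: true; x] | x <- binary m] ++ [:: false; false].

Definition computable2 (f : nat -> nat -> nat) : Prop :=
  exists M : TM, forall p d : nat, exists t : nat,
    let c := run M t (encnat p ++ encnat d) in
    c_state c = q_acc M /\ output c = map (@sym_of_bit M) (binary (f p d)).

Section Graphs.
Variables (n : nat) (e : rel 'I_n).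

Definition max_degree : nat := \max_(v : 'I_n) #|[set u | e v u]|.

Definition path_decomposition (bags : seq {set 'I_n}) : Prop :=
  [/\ (forall v : 'I_n, exists2 X, X \in bags & v \in X),
      (forall u v : 'I_n, e u v -> exists2 X, X \in bags & (u \in X) && (v \in X))
    & (forall (i j l : nat) (v : 'I_n), i <= j -> j <= l -> l < size bags ->
         v \in nth set0 bags i -> v \in nth set0 bags l -> v \in nth set0 bags j)].

Definition pathwidth_le (p : nat) : Prop :=
  exists bags, path_decomposition bags /\ (forall X, X \in bags -> #|X| <= p.+1).

Definition is_pathwidth (p : nat) : Prop :=
  pathwidth_le p /\ (forall q, pathwidth_le q -> p <= q).

(* strat t = set of vertices protected in the protection phase of      *)
(* step t (t > 0).  ff_state t = (burned, protected) after step t.     *)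

Variables (s : 'I_n) (b : nat).

Fixpoint ff_state (strat : nat -> {set 'I_n}) (t : nat) : {set 'I_n} * {set 'I_n} :=
  match t with
  | 0 => ([set s], set0)
  | t'.+1 =>
      let: (B, P) := ff_state strat t' in
      let P' := P :|: strat t in
      (B :|: [set v | (v \notin P') && [exists u in B, e u v]], P')
  end.

Definition valid_strategy (strat : nat -> {set 'I_n}) : Prop :=
  forall t, 0 < t ->
    #|strat t| <= b /\ [disjoint strat t & (ff_state strat t.-1).1].

Definition firefighter_yes (k : nat) : Prop :=
  exists strat, valid_strategy strat /\
    forall t, #|(ff_state strat t).1| <= k.

End Graphs.

Definition enc_instance (n : nat) (e : rel 'I_n) (s : 'I_n) (b k : nat) : seq bool :=
  encnat n ++ encnat (val s) ++ encnat b ++ encnat k ++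
  [seq e i j | i <- enum 'I_n, j <- enum 'I_n].

(* Main.v *)
Require Import Defs.
From mathcomp Require Import all_boot zify.
From Stdlib Require Import FunctionalExtensionality Classical.

(** In a graph of bounded pathwidth and degree a fire can always be confined to
    a bounded number [g] of vertices. Let the fire burn up to some distance [D];
    the part of it that burns after that reaches the bags of the decomposition
    through boundedly many vertices [z], and if the nearest bags on both sides of
    each [z] that the fire misses up to a much larger distance [D'] are protected
    in the meantime, then every bag that the fire can still reach has lost a
    vertex. As many rounds as there are vertices in a bag suffice.

    The algorithm simulates the fire and decides, for each newly threatened
    vertex, from the next bit of a given sequence whether it burns or is to be
    protected in time; this is feasible iff at most [b * t] vertices have been
    threatened and protected in the first [t] steps. All sequences of length
    [0, 1, 2 ...] are tried until one succeeds, or until none of some length is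
    used up. With maximum degree [d], this happens before length [g * d + 1]: if
    [k < g] then no run needs more than [k * d] bits, otherwise the confinement with [g]
    burnt vertices is found. Thus the running time is bounded in terms of [g]
    and [d], although the pathwidth is never computed. *)

Set Implicit Arguments.
Unset Strict Implicit.
Unset Printing Implicit Defensive.

(** A threatened vertex has to burn or be protected at once, so the order of discovery is the order
    of deadlines. Protecting the saved vertices in this order, [b] per step and ahead of their
    discovery, works as soon as the counts permit it; hence the search decides only which vertices
    to save, not when. The confinement needs only one protected vertex per step. Hence every
    instance with [k >= g] is positive, and otherwise [k] itself is bounded in terms of the
    parameters. The machine cannot use [g], which it does not know; instead, each run records
    whether it ran out of bits. If all sequences of some length fail and none ran out, longer ones
    would only repeat the same runs, and the answer is negative. Actual Turing machines are
    required, for the decision as well as for the computability of the bound. Both are obtained by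
    compiling a small language whose registers are unary; [b] and [k], given in binary, are
    therefore cut off at the length of the input. *)

Definition testbit (m i : nat) : bool := odd (iter i half m).

Fixpoint bits_val (Q : nat) (f : nat -> bool) : nat :=
  if Q is Q'.+1 then f 0 + (bits_val Q' (fun i => f i.+1)).*2 else 0.

Lemma testbit0 m : testbit m 0 = odd m. Proof. by []. Qed.

Lemma testbitS m i : testbit m i.+1 = testbit m./2 i.
Proof. by rewrite /testbit iterSr. Qed.

Lemma testbit_zero i : testbit 0 i = false.
Proof. by elim: i => // i IH; rewrite testbitS. Qed.

Lemma testbit_bits_val Q f i : testbit (bits_val Q f) i = (i < Q) && f i.
Proof.
elim: Q f i => [|Q IH] f i /=; first by rewrite testbit_zero.
case: i => [|i]; last by rewrite testbitS half_bit_double IH.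
by rewrite testbit0 oddD odd_double addbF oddb.
Qed.

Lemma bits_val_lt Q f : bits_val Q f < 2 ^ Q.
Proof.
elim: Q f => [|Q IH] f //=; rewrite expnS mul2n.
have := IH (fun i => f i.+1); case: (f 0); lia.
Qed.

Lemma testbit_ge L m i : m < 2 ^ L -> L <= i -> testbit m i = false.
Proof.
elim: L m i => [|L IH] m i; first by case: m => // _ _; rewrite testbit_zero.
case: i => // i; rewrite expnS testbitS => lt_m le_i.
by apply: IH le_i; lia.
Qed.

Lemma testbit_all_ones L m : m < 2 ^ L ->
  (forall i, i < L -> testbit m i) -> m.+1 = 2 ^ L.
Proof.
elim: L m => [|L IH] m; first by case: m.
rewrite expnS => lt_m ones.
have odd_m : odd m by exact: (ones 0).
have <- : m./2.+1 = 2 ^ L; last by lia.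
by apply: IH => [|i lt_i]; [lia | rewrite -testbitS ones].
Qed.

(** The carry of a binary increment: [cNext] performs it on the tape to reach the next sequence of
    decisions. *)
Lemma testbit_succ m j : (forall i, i < j -> testbit m i) -> ~~ testbit m j ->
  testbit m.+1 = fun x => (x == j) || (j < x) && testbit m x.
Proof.
move=> ones zero; apply: functional_extensionality => x.
elim: j m x ones zero => [|j IH] m x ones zero.
  rewrite testbit0 in zero; case: x => [|x]; first by rewrite testbit0 /= zero.
  by rewrite !testbitS /=; congr testbit; lia.
have odd_m : odd m by exact: (ones 0).
case: x => [|x]; first by rewrite testbit0 /= odd_m.
rewrite !testbitS eqSS ltnS -IH; first by congr testbit; lia.
  by move=> i lt_i; rewrite -testbitS ones.
by rewrite -testbitS.
Qed.

(** * A structured language over bit tracks *)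

Definition track := nat -> bool.
Notation none := (fun _ : nat => false).

(** [While] tests the disjunction of two tracks because a cell belongs to the input iff track 0 or
    track 1 is marked there; all other loops name one track twice. *)
Inductive cmd :=
| Write of nat & bool
| GoL
| GoR
| Seq of cmd & cmd
| Ite of nat & cmd & cmd
| While of nat & nat & bool & cmd.

Definition cell (s : seq track) (x j : nat) : bool := nth none s j x.

Definition write (s : seq track) (j x : nat) (b : bool) : seq track :=
  set_nth none s j (fun y => if y == x then b else nth none s j y).

(* [exec c s h t s' h']: started on the tracks [s] with the head at [h], the
   command [c] ends after [t] steps on the tracks [s'] with the head at [h']. *)
Inductive exec : cmd -> seq track -> nat -> nat -> seq track -> nat -> Prop :=
| ExecWrite j b s h : exec (Write j b) s h 1 (write s j h b) h
| ExecL s h : exec GoL s h.+1 1 s h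
| ExecR s h : exec GoR s h 1 s h.+1
| ExecSeq c1 c2 s h t1 s1 h1 t2 s2 h2 :
    exec c1 s h t1 s1 h1 -> exec c2 s1 h1 t2 s2 h2 ->
    exec (Seq c1 c2) s h (t1 + t2) s2 h2
| ExecIte j c1 c2 s h t s' h' :
    exec (if cell s h j then c1 else c2) s h t s' h' ->
    exec (Ite j c1 c2) s h t.+1 s' h'
| ExecStop i j p c s h :
    (cell s h i || cell s h j) != p -> exec (While i j p c) s h 1 s h
| ExecLoop i j p c s h t1 s1 h1 t2 s2 h2 :
    (cell s h i || cell s h j) == p ->
    exec c s h t1 s1 h1 -> exec (While i j p c) s1 h1 t2 s2 h2 ->
    exec (While i j p c) s h (t1 + t2).+1 s2 h2.

Fixpoint width (c : cmd) : nat :=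
  match c with
  | Write j _ => j.+1
  | GoL | GoR => 0
  | Seq c1 c2 => maxn (width c1) (width c2)
  | Ite _ c1 c2 => maxn (width c1) (width c2)
  | While _ _ _ c => width c
  end.

(** * Compilation to Turing machines *)

Definition entry := (nat -> bool) -> nat * option (nat * bool) * move.

Fixpoint code_size (c : cmd) : nat :=
  match c with
  | Write _ _ | GoL | GoR => 1
  | Seq c1 c2 => code_size c1 + code_size c2
  | Ite _ c1 c2 => (code_size c1 + code_size c2).+1
  | While _ _ _ c => (code_size c).+1
  end.

(* Code for [c] located at state [q] that leaves to state [r]. *)
Fixpoint compile (c : cmd) (q r : nat) : seq entry :=
  match c with
  | Write j b => [:: fun _ => (r, Some (j, b), MStay)]
  | GoL => [:: fun _ => (r, None, MLeft)]
  | GoR => [:: fun _ => (r, None, MRight)]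
  | Seq c1 c2 =>
      compile c1 q (q + code_size c1) ++ compile c2 (q + code_size c1) r
  | Ite j c1 c2 =>
      (fun a : nat -> bool =>
         (if a j then q.+1 else q.+1 + code_size c1, None, MStay)) ::
      compile c1 q.+1 r ++ compile c2 (q.+1 + code_size c1) r
  | While i j p c =>
      (fun a : nat -> bool =>
         (if (a i || a j) == p then q.+1 else r, None, MStay)) ::
      compile c q.+1 q
  end.

Lemma size_compile c q r : size (compile c q r) = code_size c.
Proof.
elim: c q r => //= [c1 IH1 c2 IH2|j c1 IH1 c2 IH2|i j p c IH] q r.
- by rewrite size_cat IH1 IH2.
- by rewrite size_cat IH1 IH2.
- by rewrite IH.
Qed.

Section Machine.
Variables (Q : nat) (tbl : seq entry).

Definition set_bit (a : nat -> bool) (w : option (nat * bool)) : nat -> bool :=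
  if w is Some (j, b) then fun i => if i == j then b else a i else a.

Definition no_entry : entry := fun _ => (0, None, MStay).

(* Bit [j] of the number of a symbol is the content of track [j]; thus the
   blank is the empty cell, and the input bits 0 and 1, which are the symbols
   1 and 2, are marks on the tracks 0 and 1. *)
Definition machine : TM :=
  {| tm_nQ := size tbl; tm_nS := 2 ^ Q;
     tm_delta := fun q x =>
       let: (r, w, m) := nth no_entry tbl q (testbit x) in
       (inord r, inord (bits_val Q (set_bit (testbit x) w)), m) |}.

Definition symbol (s : seq track) (x : nat) : tsym machine :=
  inord (bits_val Q (cell s x)).

(** The left part of the tape consists of exactly the [h] cells before the head, but the right part
    is a finite list that stands for infinitely many cells, so it is compared through [nth] with the
    blank as default. *)
Record represents (c : config machine) (q : nat) (s : seq track) (h : nat) : Prop := {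
  rep_state : c_state c = inord q;
  rep_left : c_left c = map (symbol s) (rev (iota 0 h));
  rep_cur : c_cur c = symbol s h;
  rep_right : forall i, nth (blank machine) (c_right c) i = symbol s (h + i.+1) }.

Lemma cell_ge s x j : size s <= j -> cell s x j = false.
Proof. by move=> le_s; rewrite /cell nth_default. Qed.

Lemma symbolE s x : symbol s x = bits_val Q (cell s x) :> nat.
Proof. by rewrite /symbol inordK //=; have := bits_val_lt Q (cell s x); lia. Qed.

Lemma testbit_symbol s x : size s <= Q -> testbit (symbol s x) = cell s x.
Proof.
move=> le_s; apply: functional_extensionality => j.
rewrite symbolE testbit_bits_val; case: ltnP => //= le_j.
by rewrite cell_ge // (leq_trans le_s).
Qed.

Definition written (s : seq track) (h : nat) (w : option (nat * bool)) :=
  if w is Some (j, b) then write s j h b else s.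

Lemma cell_written s h w x :
  cell (written s h w) x = if x == h then set_bit (cell s x) w else cell s x.
Proof.
case: w => [[j b]|] /=; last by case: eqP.
apply: functional_extensionality => i; rewrite /cell /write nth_set_nth /=.
by case: (i =P j) => [->|]; case: eqP => //=; case: eqP.
Qed.

Lemma symbol_written s h w x : x != h -> symbol (written s h w) x = symbol s x.
Proof. by move=> /negPf ne; rewrite /symbol cell_written ne. Qed.

Lemma represents_step c q s h r w m :
  represents c q s h -> size s <= Q -> 3 <= q < size tbl ->
  nth no_entry tbl q (cell s h) = (r, w, m) ->
  match m with
  | MStay => represents (step c) r (written s h w) h
  | MRight => represents (step c) r (written s h w) h.+1
  | MLeft => forall h', h = h'.+1 -> represents (step c) r (written s h w) h'
  end.
Proof.
case: c => st l x rt [/= st_q l_eq x_eq r_eq] le_s /andP[ge3 lt_q] ent.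
have st_val : st = q :> nat by rewrite st_q inordK //=; lia.
have Estep : step (Config st l x rt) =
  let a := symbol (written s h w) h in
  match m with
  | MStay => Config (inord r) l a rt
  | MLeft => match l with
             | [::] => Config (inord r) [::] (blank _) (a :: rt)
             | y :: l' => Config (inord r) l' y (a :: rt)
             end
  | MRight => match rt with
              | [::] => Config (inord r) (a :: l) (blank _) [::]
              | y :: r' => Config (inord r) (a :: l) y r'
              end
  end.
  rewrite /step /halted /=.
  have -> : (st == q_acc machine) || (st == q_rej machine) = false.
    by apply/norP; split; apply/eqP => /(congr1 val) /=; rewrite st_val inordK //; lia.
  rewrite x_eq testbit_symbol // st_val ent.
  suff -> : inord (bits_val Q (set_bit (cell s h) w)) = symbol (written s h w) h.
    by case: m ent.
  by rewrite /symbol cell_written eqxx.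
have left_eq : l = [seq symbol (written s h w) i | i <- rev (iota 0 h)].
  rewrite l_eq; apply/eq_in_map => i; rewrite mem_rev mem_iota => /andP[_ lt_i].
  by rewrite symbol_written //; apply/eqP; lia.
have right_eq i : nth (blank machine) rt i = symbol (written s h w) (h + i.+1).
  by rewrite r_eq symbol_written //; apply/eqP; lia.
set s1 := written s h w in left_eq right_eq Estep *.
case: m ent Estep => ent ->.
- move=> h' eq_h; rewrite eq_h in left_eq right_eq *.
  have El : l = symbol s1 h' :: [seq symbol s1 i | i <- rev (iota 0 h')].
    by rewrite left_eq -addn1 iotaD add0n rev_cat.
  rewrite El /=; split => //= i; case: i => [|i] /=; first by rewrite addn1.
  by rewrite right_eq; congr symbol; lia.
- have El : symbol s1 h :: l = [seq symbol s1 i | i <- rev (iota 0 h.+1)].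
    by rewrite left_eq -(addn1 h) iotaD add0n rev_cat.
  case: rt r_eq right_eq => [|y rt] r_eq right_eq; split => //=.
  + by rewrite -[h.+1]addn1 -right_eq.
  + by move=> i; rewrite nth_nil addSnnS -right_eq nth_nil.
  + by rewrite -[h.+1]addn1 -right_eq.
  + by move=> i; rewrite addSnnS -right_eq.
- by split.
Qed.

Lemma nth_at (pre post : seq entry) (e : entry) q :
  tbl = pre ++ e :: post -> size pre = q ->
  nth no_entry tbl q = e /\ q < size tbl.
Proof.
move=> -> <-; rewrite nth_cat ltnn subnn size_cat /=; split => //; lia.
Qed.

(** Induction on the derivation and not on the command, since the code of a loop body is executed
    repeatedly at the same states. States below 3 are excluded: 0, 1 and 2 are the start state and
    the two halting states. *)
Lemma compile_exec c s h t s' h' : exec c s h t s' h' -> width c <= Q ->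
  forall q r pre post, tbl = pre ++ compile c q r ++ post -> size pre = q ->
  3 <= q -> forall cfg, represents cfg q s h -> size s <= Q ->
  represents (iter t (@step machine) cfg) r s' h' /\ size s' <= Q.
Proof.
elim=> {c s h t s' h'}.
- move=> j b s h /= le_j q r pre post Et Eq ge3 cfg rep le_s.
  have [En lt_q] := nth_at Et Eq.
  split; last by rewrite size_set_nth geq_max le_j.
  by apply: (represents_step (w := Some (j, b)) (m := MStay) rep) => //; rewrite ?ge3 ?En.
- move=> s h /= _ q r pre post Et Eq ge3 cfg rep le_s; split=> //.
  have [En lt_q] := nth_at Et Eq.
  by apply: (represents_step (w := None) (m := MLeft) rep) => //; rewrite ?ge3 ?En.
- move=> s h /= _ q r pre post Et Eq ge3 cfg rep le_s; split=> //.
  have [En lt_q] := nth_at Et Eq.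
  by apply: (represents_step (w := None) (m := MRight) rep) => //; rewrite ?ge3 ?En.
- move=> c1 c2 s h t1 s1 h1 t2 s2 h2 _ IH1 _ IH2 /=; rewrite geq_max => /andP[w1 w2].
  move=> q r pre post Et Eq ge3 cfg rep le_s; rewrite addnC iterD.
  rewrite -catA in Et.
  have [rep1 le_s1] := IH1 w1 _ _ _ _ Et Eq ge3 _ rep le_s.
  apply: (IH2 w2 _ _ (pre ++ compile c1 q (q + code_size c1)) post) rep1 le_s1.
  + by rewrite Et -!catA.
  + by rewrite size_cat size_compile Eq.
  + lia.
- move=> j c1 c2 s h t s' h' _ IH /=; rewrite geq_max => /andP[w1 w2].
  move=> q r pre post Et Eq ge3 cfg rep le_s; rewrite -iterS iterSr.
  have [En lt_q] := nth_at Et Eq.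
  have rep1 : represents (step cfg)
      (if cell s h j then q.+1 else q.+1 + code_size c1) s h.
    by apply: (represents_step (w := None) (m := MStay) rep) => //; rewrite ?ge3 ?En.
  set e0 := (X in X :: _) in Et.
  case: (cell s h j) in IH rep1.
  + apply: (IH w1 _ r (rcons pre e0) (compile c2 (q.+1 + code_size c1) r ++ post)) rep1 le_s.
    * by rewrite Et -cats1 /= -!catA.
    * by rewrite size_rcons Eq.
    * lia.
  + apply: (IH w2 _ r (rcons pre e0 ++ compile c1 q.+1 r) post) rep1 le_s.
    * by rewrite Et -cats1 /= -!catA.
    * by rewrite size_cat size_rcons size_compile Eq.
    * lia.
- move=> i j p c s h test /= _ q r pre post Et Eq ge3 cfg rep le_s; split=> //.
  have [En lt_q] := nth_at Et Eq.
  apply: (represents_step (w := None) (m := MStay) rep) => //; rewrite ?ge3 ?En //=.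
  by rewrite (negPf test).
- move=> i j p c s h t1 s1 h1 t2 s2 h2 test _ IH1 _ IH2 /= wc.
  move=> q r pre post Et Eq ge3 cfg rep le_s.
  have [En lt_q] := nth_at Et Eq.
  have rep0 : represents (step cfg) q.+1 s h.
    apply: (represents_step (w := None) (m := MStay) rep) => //; rewrite ?ge3 ?En //=.
    by rewrite test.
  rewrite -iterS iterSr addnC iterD.
  set e0 := (X in X :: _) in Et.
  have Et1 : tbl = rcons pre e0 ++ compile c q.+1 q ++ post.
    by rewrite Et -cats1 /= -!catA.
  have szp : size (rcons pre e0) = q.+1 by rewrite size_rcons Eq.
  have [rep1 le_s1] := IH1 wc _ _ _ _ Et1 szp (ltnW ge3) _ rep0 le_s.
  exact: (IH2 wc _ _ _ _ Et Eq ge3 _ rep1 le_s1).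
Qed.

End Machine.

(** * Complete machines: initial tape, verdict and output *)

Definition input_tracks (w : seq bool) : seq track :=
  [:: (fun x => (0 < x <= size w) && ~~ nth false w x.-1);
      (fun x => (0 < x) && nth false w x.-1)].

Lemma cell_input w x : cell (input_tracks w) x =
  if 0 < x <= size w then fun j => j == nat_of_bool (nth false w x.-1) else none.
Proof.
apply: functional_extensionality => -[|[|j]]; rewrite /cell /=.
- by case: ifP => //= _; case: nth.
- case: ifP => [/andP[-> _]|] /=; first by case: nth.
  by case: x => //= x; rewrite ltnNge => /negbFE le; rewrite nth_default.
- by rewrite nth_nil; case: ifP => // _; case: nth.
Qed.

Lemma bits_val_pred1 Q j : j < Q -> bits_val Q (fun i => i == j) = 2 ^ j.
Proof.
elim: Q j => // Q IH [|j] /=.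
  move=> _; suff -> : bits_val Q (fun i => i.+1 == 0) = 0 by [].
  by elim: Q {IH} => //= Q ->.
by move=> lt_j; rewrite expnS mul2n -IH.
Qed.

Lemma bits_val_testbit Q m : m < 2 ^ Q -> bits_val Q (testbit m) = m.
Proof.
elim: Q m => [|Q IH] m /=; first by case: m.
have -> : (fun i => testbit m i.+1) = testbit m./2.
  by apply: functional_extensionality => i; rewrite testbitS.
by rewrite expnS => lt_m; rewrite IH ?testbit0; lia.
Qed.

Lemma bits_val_none Q : bits_val Q none = 0.
Proof. by elim: Q => //= Q ->. Qed.

(** The initial step to the left frees position 0 for the home mark, so that the input starts at
    position 1. States 1 and 2 halt and have dummy entries; the last state turns the track
    [rejecting] under the head into the verdict. *)
Definition program (c : cmd) (rejecting : nat) : seq entry :=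
  [:: (fun _ => (3, None, MLeft)); no_entry; no_entry] ++
  compile c 3 (3 + code_size c) ++
  [:: fun a : nat -> bool => (if a rejecting then 2 else 1, None, MStay)].

Section Run.
Variables (c : cmd) (rejecting : nat).
Let Q := maxn 2 (width c).
Let M := machine Q (program c rejecting).

Let sym_cell (s : seq track) x (b : bool) :
  cell s x = (fun j => j == nat_of_bool b) ->
  symbol Q (program c rejecting) s x = sym_of_bit M b.
Proof.
move=> cell_x; rewrite /symbol cell_x bits_val_pred1; first by case: (b).
by apply: leq_trans (leq_maxl _ _); case: (b).
Qed.

Let sym_none (s : seq track) x :
  cell s x = none -> symbol Q (program c rejecting) s x = blank M.
Proof. by move=> cell_x; apply/ord_inj; rewrite symbolE cell_x bits_val_none. Qed.

Let represents_init w : represents (step (init M w)) 3 (input_tracks w) 0.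
Proof.
have Q2 : 2 <= Q by apply: leq_maxl.
have Q4 : 4 <= 2 ^ Q by rewrite (@leq_exp2l 2 2).
have in_sym i : nth (blank M) (map (@sym_of_bit M) w) i =
    symbol Q (program c rejecting) (input_tracks w) i.+1.
  case: (ltnP i (size w)) => [lt_i | le_i].
    rewrite (nth_map false) //; symmetry; apply: sym_cell.
    by rewrite cell_input /= lt_i.
  rewrite nth_default ?size_map //; symmetry; apply: sym_none.
  by rewrite cell_input /= ltnNge le_i.
have start0 : symbol Q (program c rejecting) (input_tracks w) 0 = blank M.
  by apply: sym_none; rewrite cell_input.
(* Even a state that writes nothing rebuilds the symbol from [Q] bits; the symbols of the initial
   tape survive this because [Q] is at least 2. *)
have small (a : tsym M) : a < 4 -> inord (bits_val Q (testbit a)) = a.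
  by move=> lt_a; rewrite bits_val_testbit ?inord_val // (leq_trans lt_a).
have Estep (a : tsym M) rt : a < 4 -> @step M (Config (q_start M) [::] a rt) =
    Config (inord 3) [::] (blank M) (a :: rt).
  move=> lt_a; rewrite /step /halted /=.
  have -> : (q_start M == q_acc M) || (q_start M == q_rej M) = false.
    by apply/norP; split; apply/eqP => /(congr1 val) /=; rewrite inordK.
  by rewrite small.
have lt4 b : sym_of_bit M b < 4 by rewrite inordK /=; case: b; lia.
case: w in_sym start0 => [|b w] in_sym start0.
  rewrite Estep //; split=> //= i.
  by rewrite add0n -in_sym; case: i => //= i; rewrite nth_nil.
by rewrite Estep //; split=> //= i; rewrite add0n -in_sym.
Qed.

Let iter_halted cfg t : halted cfg -> iter t (@step M) cfg = cfg.
Proof. by move=> hc; elim: t => //= t ->; rewrite /step hc. Qed.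

(** The two steps added to those of [c] are the initial move and the verdict. As a halted machine
    stays put, every larger [T] gives the same configuration. *)
Lemma run_program w t s h : exec c (input_tracks w) 0 t s h ->
  forall T, t.+2 <= T -> let cfg := run M T w in
  c_state cfg = (if cell s h rejecting then q_rej M else q_acc M) /\
  forall bits, (forall i, i < size bits ->
      cell s (h + i) = fun j => j == nat_of_bool (nth false bits i)) ->
    cell s (h + size bits) = none -> output cfg = map (@sym_of_bit M) bits.
Proof.
move=> ex T le_T.
have sz : size (program c rejecting) = (3 + code_size c).+1.
  by rewrite !size_cat size_compile /= !addnS addn0.
have [||rep le_s] := @compile_exec Q (program c rejecting) _ _ _ _ _ _ ex _ 3
    (3 + code_size c) _ _ (erefl _) (erefl _) isT _ (represents_init w).
- exact: leq_maxr.
- exact: leq_maxl.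
have En : nth no_entry (program c rejecting) (3 + code_size c) =
    fun a : nat -> bool => (if a rejecting then 2 else 1, None, MStay).
  by rewrite /program catA nth_cat size_cat size_compile /= ltnn subnn.
have := represents_step (r := if cell s h rejecting then 2 else 1)
  (w := None) (m := MStay) rep le_s.
rewrite sz ltnSn En => /(_ isT erefl) [st lf cu rt].
set cfg := step _ in st lf cu rt.
have st' : c_state cfg = if cell s h rejecting then q_rej M else q_acc M.
  by rewrite st; case: ifP.
have hc : halted cfg by rewrite /halted st'; case: ifP; rewrite eqxx ?orbT.
have -> : run M T w = cfg.
  rewrite /run -(subnK le_T) iterD -[RHS](iter_halted (T - t.+2) hc).
  by congr iter; rewrite /cfg -iterS -iterSr.
split=> // bits body stop; rewrite /output.
have tape i : nth (blank M) (c_cur cfg :: c_right cfg) i =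
    symbol Q (program c rejecting) s (h + i).
  by case: i => [|i] /=; rewrite ?addn0 ?cu ?rt.
elim: bits h (c_cur cfg :: c_right cfg) tape body stop {ex rep st lf cu rt st' En}.
- move=> h [|x r] tape _ stop //=; case: eqP => // ne; case: ne.
  by have /= -> := tape 0; apply: sym_none.
- move=> b bits IH h r tape body stop.
  have sym0 : symbol Q (program c rejecting) s (h + 0) = sym_of_bit M b.
    by apply: sym_cell; rewrite body.
  have ne : sym_of_bit M b != blank M.
    by apply/eqP => /(congr1 val) /=; rewrite inordK //;
       have := expn_gt0 2 Q; case: (b); rewrite /=; lia.
  case: r tape => [|x r] tape; first by rewrite -sym0 -tape eqxx in ne.
  have /= := tape 0; rewrite sym0 => ->; rewrite (negPf ne); congr (_ :: _).
  apply: (IH h.+1) => [i|i lt_i|]; last by rewrite addSnnS.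
  + by rewrite addSnnS -tape.
  + by rewrite addSnnS body.
Qed.

End Run.

(** * Registers and loops *)

(* A register is a track with a single mark, located at its value. Track 2 is
   the register with value 0: it delimits the tape on the left. *)
Definition mark (v : nat) : track := fun x => x == v.

Definition goto j := While j j false GoR.
Definition home := While 2 2 false GoL.
Definition Inc j :=
  Seq (goto j) (Seq (Write j false) (Seq GoR (Seq (Write j true) home))).
Definition Dec j :=
  Seq (goto j) (Seq (Write j false) (Seq GoL (Seq (Write j true) home))).
Definition Zero j := Seq (goto j) (Seq (Write j false) (Seq home (Write j true))).
Definition Copy j i :=
  Seq (goto j) (Seq (Write j false)
    (Seq home (Seq (goto i) (Seq (Write j true) home)))).
Definition Put a j b := Seq (goto j) (Seq (Write a b) home).
Definition If a j c1 c2 := Seq (goto j) (Ite a (Seq home c1) (Seq home c2)).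
Definition Loop a b p j c :=
  Seq (goto j) (Seq (While a b p (Seq home (Seq c (goto j)))) home).
(** Since registers are marks, a comparison is the test of a single cell: track [n] is marked at the
    position of [i] iff the two values agree. Likewise, testing track 2 at a register asks whether
    its value is 0. *)
Definition For i n c := Seq (Loop n n false i (Seq c (Inc i))) (Zero i).
Definition Skip := home.

Notation std s := (nth none s 2 = mark 0).

(* [k] counts instructions, each of which takes at most [8 * M + 30] steps as
   long as the registers it uses are bounded by [M]. *)
Definition runs (M : nat) (c : cmd) (s s' : seq track) (k : nat) : Prop :=
  exists2 t, t <= k * (8 * M + 30) & exec c s 0 t s' 0.

Lemma exec_eq c s h t s' h' t1 : exec c s h t s' h' -> t = t1 -> exec c s h t1 s' h'.
Proof. by move=> ex <-. Qed.

Lemma exec_seq_inv c1 c2 s h t s2 h2 : exec (Seq c1 c2) s h t s2 h2 ->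
  exists t1 t2 s1 h1, [/\ exec c1 s h t1 s1 h1, exec c2 s1 h1 t2 s2 h2 & t = t1 + t2].
Proof.
move=> ex; inversion ex as [| | | ? ? ? ? t1 s1 h1 t2 ? ? ex1 ex2| | |]; subst.
by exists t1, t2, s1, h1.
Qed.

Lemma exec_goto s j v : nth none s j = mark v -> exec (goto j) s 0 (2 * v).+1 s v.
Proof.
move=> s_j; suff from d h : d + h = v -> exec (goto j) s h (2 * d).+1 s v.
  by apply: from; rewrite addn0.
have test x : cell s x j || cell s x j = (x == v) by rewrite /cell s_j orbb.
elim: d h => [|d IH] h; first by rewrite add0n => ->; apply: ExecStop; rewrite test eqxx.
move=> eq_v; apply: exec_eq (ExecLoop _ (ExecR _ _) (IH h.+1 _)) _; first 1 last.
- by rewrite addnS.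
- lia.
- by rewrite test; apply/eqP/eqP; lia.
Qed.

Lemma exec_home s h : std s -> exec home s h (2 * h).+1 s 0.
Proof.
move=> s_2; have test x : cell s x 2 || cell s x 2 = (x == 0) by rewrite /cell s_2 orbb.
elim: h => [|h IH]; first by apply: ExecStop; rewrite test.
by apply: exec_eq (ExecLoop _ (ExecL _ _) IH) _; [rewrite test | lia].
Qed.

Lemma write_mark s j v :
  nth none s j = mark v -> write s j v false = set_nth none s j none.
Proof.
move=> s_j; congr set_nth; apply: functional_extensionality => y.
by rewrite s_j /mark; case: eqP.
Qed.

Lemma write_none s j v :
  nth none s j = none -> write s j v true = set_nth none s j (mark v).
Proof.
move=> s_j; congr set_nth; apply: functional_extensionality => y.
by rewrite s_j /mark; case: eqP.
Qed.

Lemma nth_set_same (s : seq track) j f : nth none (set_nth none s j f) j = f.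
Proof. by rewrite nth_set_nth /= eqxx. Qed.

Lemma nth_set_other (s : seq track) j f i :
  i != j -> nth none (set_nth none s j f) i = nth none s i.
Proof. by move=> ne; rewrite nth_set_nth /= (negPf ne). Qed.

Lemma set_set_same (s : seq track) j f g :
  set_nth none (set_nth none s j f) j g = set_nth none s j g.
Proof. by rewrite set_set_nth eqxx. Qed.

Section Runs.
Variable M : nat.

Lemma runs_weaken c s s' k k' : k <= k' -> runs M c s s' k -> runs M c s s' k'.
Proof.
move=> le [t le_t ex]; exists t => //.
by apply: leq_trans le_t _; rewrite leq_mul2r le orbT.
Qed.

Lemma runs_seq c1 c2 s s1 s2 k1 k2 :
  runs M c1 s s1 k1 -> runs M c2 s1 s2 k2 -> runs M (Seq c1 c2) s s2 (k1 + k2).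
Proof.
move=> [t1 le1 ex1] [t2 le2 ex2]; exists (t1 + t2); last exact: ExecSeq ex1 ex2.
by rewrite mulnDl leq_add.
Qed.

Lemma runs_skip s : std s -> runs M Skip s s 1.
Proof. by move=> st; exists 1; [lia | apply: exec_home]. Qed.

Lemma runs_inc s j v : std s -> 2 != j -> nth none s j = mark v -> v <= M ->
  runs M (Inc j) s (set_nth none s j (mark v.+1)) 1.
Proof.
move=> st ne s_j le_v; eexists; last first.
  apply: ExecSeq (exec_goto s_j) (ExecSeq (ExecWrite _ _ _ _) (ExecSeq (ExecR _ _) _)).
  rewrite write_mark //; apply: ExecSeq (ExecWrite _ _ _ _) _.
  rewrite write_none ?nth_set_same // set_set_same.
  by apply: exec_home; rewrite nth_set_other.
lia.
Qed.

Lemma runs_dec s j v : std s -> 2 != j -> nth none s j = mark v.+1 -> v <= M ->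
  runs M (Dec j) s (set_nth none s j (mark v)) 1.
Proof.
move=> st ne s_j le_v; eexists; last first.
  apply: ExecSeq (exec_goto s_j) (ExecSeq (ExecWrite _ _ _ _) (ExecSeq (ExecL _ _) _)).
  rewrite write_mark //; apply: ExecSeq (ExecWrite _ _ _ _) _.
  rewrite write_none ?nth_set_same // set_set_same.
  by apply: exec_home; rewrite nth_set_other.
lia.
Qed.

Lemma runs_zero s j v : std s -> 2 != j -> nth none s j = mark v -> v <= M ->
  runs M (Zero j) s (set_nth none s j (mark 0)) 1.
Proof.
move=> st ne s_j le_v; eexists; last first.
  apply: ExecSeq (exec_goto s_j) (ExecSeq (ExecWrite _ _ _ _) (ExecSeq _ _)).
    by rewrite write_mark //; apply: exec_home; rewrite nth_set_other.
  have <- : write (set_nth none s j none) j 0 true = set_nth none s j (mark 0).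
    by rewrite write_none ?nth_set_same // set_set_same.
  exact: ExecWrite.
lia.
Qed.

(** The factor 8 in [runs] comes from this instruction: it walks to the old mark, home, to the
    source and home again, with two steps per cell. *)
Lemma runs_copy s j i u v : std s -> 2 != j -> i != j ->
  nth none s j = mark u -> u <= M -> nth none s i = mark v -> v <= M ->
  runs M (Copy j i) s (set_nth none s j (mark v)) 1.
Proof.
move=> st ne ne' s_j le_u s_i le_v; eexists; last first.
  apply: ExecSeq (exec_goto s_j) (ExecSeq (ExecWrite _ _ _ _) _).
  rewrite write_mark //; apply: ExecSeq (exec_home _ _) _.
    by rewrite nth_set_other.
  apply: ExecSeq (exec_goto _) (ExecSeq (ExecWrite _ _ _ _) _).
    by rewrite nth_set_other // s_i.
  rewrite write_none ?nth_set_same // set_set_same.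
  by apply: exec_home; rewrite nth_set_other.
lia.
Qed.

Lemma runs_put s a j b v : std s -> 2 != a -> nth none s j = mark v -> v <= M ->
  runs M (Put a j b) s
    (set_nth none s a (fun y => if y == v then b else nth none s a y)) 1.
Proof.
move=> st ne s_j le_v; eexists; last first.
  apply: ExecSeq (exec_goto s_j) (ExecSeq (ExecWrite _ _ _ _) _).
  by apply: exec_home; rewrite nth_set_other.
lia.
Qed.

Lemma runs_if s s' a j c1 c2 v k : std s -> nth none s j = mark v -> v <= M ->
  runs M (if nth none s a v then c1 else c2) s s' k ->
  runs M (If a j c1 c2) s s' k.+1.
Proof.
move=> st s_j le_v [t le_t ex]; eexists; last first.
  apply: ExecSeq (exec_goto s_j) (ExecIte _).
  have -> : (if cell s v a then Seq home c1 else Seq home c2) =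
     Seq home (if nth none s a v then c1 else c2) by rewrite /cell; case: ifP.
  exact: ExecSeq (exec_home _ st) ex.
by rewrite mulSn; lia.
Qed.

Section Loop.
Variables (a b : nat) (p : bool) (j : nat) (c : cmd).

Lemma runs_loop_stop s v : std s -> nth none s j = mark v -> v <= M ->
  (nth none s a v || nth none s b v) != p -> runs M (Loop a b p j c) s s 1.
Proof.
move=> st s_j le_v test; eexists; last first.
  exact: ExecSeq (exec_goto s_j) (ExecSeq (ExecStop _ test) (exec_home _ st)).
lia.
Qed.

(** A run of the loop from [s1] begins with the walk to register [j]; in the longer run the same
    walk is the end of the first pass through the body. Hence the given run is taken apart and its
    pieces are regrouped. *)
Lemma runs_loop_step s s1 s2 v k1 k2 :
  std s -> nth none s j = mark v -> v <= M ->
  (nth none s a v || nth none s b v) == p ->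
  runs M c s s1 k1 -> runs M (Loop a b p j c) s1 s2 k2 ->
  runs M (Loop a b p j c) s s2 (k1 + k2).+1.
Proof.
move=> st s_j le_v test [t1 le1 ex1] [t2 le2 ex2].
have [u1 [u2 [s1' [h1 [go rest eq_t2]]]]] := exec_seq_inv ex2.
have [u3 [u4 [s2' [h2 [body back eq_u2]]]]] := exec_seq_inv rest.
eexists; last first.
  apply: ExecSeq (exec_goto s_j) (ExecSeq (ExecLoop test _ body) back).
  exact: ExecSeq (exec_home _ st) (ExecSeq ex1 go).
lia.
Qed.

Lemma runs_loop (st : nat -> seq track) (v : nat -> nat) N k :
  (forall i, i <= N -> [/\ std (st i), nth none (st i) j = mark (v i) & v i <= M]) ->
  (forall i, i < N -> (nth none (st i) a (v i) || nth none (st i) b (v i)) == p) ->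
  (nth none (st N) a (v N) || nth none (st N) b (v N)) != p ->
  (forall i, i < N -> runs M c (st i) (st i.+1) k) ->
  runs M (Loop a b p j c) (st 0) (st N) (N * k.+1).+1.
Proof.
elim: N st v => [|N IH] st v inv test stop body.
  by have [? ? ?] := inv 0 isT; rewrite mul0n; apply: runs_loop_stop stop.
have [s2 s_j le_v] := inv 0 isT.
have := runs_loop_step s2 s_j le_v (test 0 isT) (body 0 isT)
  (IH (fun i => st i.+1) (fun i => v i.+1) _ _ _ _).
by rewrite mulSn addSn addnS; apply=> // i lt_i; [apply: inv | apply: test | apply: body].
Qed.

End Loop.

(** [st x] is the memory before pass [x] of the body, and [st' x] the memory after it, with the
    index not yet advanced. *)
Lemma runs_for i n c (st st' : nat -> seq track) s' N k :
  2 != i -> N <= M ->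
  (forall x, std (st x)) -> (forall x, std (st' x)) ->
  (forall x, nth none (st x) i = mark x) -> (forall x, nth none (st' x) i = mark x) ->
  (forall x, nth none (st x) n = mark N) ->
  (forall x, set_nth none (st' x) i (mark x.+1) = st x.+1) ->
  set_nth none (st N) i (mark 0) = s' ->
  (forall x, x < N -> runs M c (st x) (st' x) k) ->
  runs M (For i n c) (st 0) s' (N * k.+2).+2.
Proof.
move=> ne le_N st2 st'2 st_i st'_i st_n stS <- body.
have run_end : runs M (Zero i) (st N) (set_nth none (st N) i (mark 0)) 1.
  exact: runs_zero (st_i N) le_N.
apply: runs_weaken (runs_seq (@runs_loop n n false i _ st id N k.+1 _ _ _ _) run_end).
- by rewrite addn1.
- by move=> x le_x; split=> //; apply: leq_trans le_N.
- by move=> x lt_x; rewrite st_n /mark orbb; apply/eqP/eqP; lia.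
- by rewrite st_n /mark orbb eqxx.
- move=> x lt_x; rewrite -stS; apply: (@runs_weaken _ _ _ (k + 1)); first by rewrite addn1.
  apply: runs_seq (body x lt_x) _.
  by apply: runs_inc => //; apply: ltnW; apply: leq_trans le_N.
Qed.

(** A Boolean variable lives in cell 0 of its track, so it is addressed by register 2, whose value
    is 0. *)
Definition flag (v : bool) : track := fun x => if x == 0 then v else false.

Lemma runs_flag s a v u : std s -> 2 != a -> nth none s a = flag u ->
  runs M (Put a 2 v) s (set_nth none s a (flag v)) 1.
Proof.
move=> s2 ne s_a; have := runs_put v s2 ne s2 (leq0n M); rewrite s_a.
suff -> : (fun y => if y == 0 then v else flag u y) = flag v by [].
by apply: functional_extensionality => y; rewrite /flag; case: eqP.
Qed.

End Runs.

Arguments runs_weaken {M c s s' k k'}.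
Arguments runs_seq {M c1 c2 s s1 s2 k1 k2}.
Arguments runs_skip {M s}.
Arguments runs_inc {M s j v}.
Arguments runs_dec {M s j v}.
Arguments runs_zero {M s j v}.
Arguments runs_copy {M s j i u v}.
Arguments runs_put {M s a j b v}.
Arguments runs_flag {M s a v u}.
Arguments runs_if {M s s' a j c1 c2 v k}.
Arguments runs_loop_stop {M a b p j c s v}.
Arguments runs_loop_step {M a b p j c s s1 s2 v k1 k2}.
Arguments runs_loop {M a b p j c st v N k}.
Arguments runs_for {M i n c st st' s' N k}.

(** * Containing the fire in graphs of bounded pathwidth and degree *)

Section Fire.
Variables (n : nat) (e : rel 'I_n) (s : 'I_n).
Implicit Types (X B : {set 'I_n}) (t : nat).

Definition nbr B : {set 'I_n} := [set v | [exists u in B, e u v]].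

(** The fire as it would spread if all of [X] were protected from the outset; whether [X] can be
    protected in time is left to the third condition of [contains]. *)
Fixpoint ball X t : {set 'I_n} :=
  if t is t'.+1 then ball X t' :|: (nbr (ball X t') :\: X) else [set s].

(* A set [X] that can be protected in time, in the order in which the fire
   would reach its vertices, and that leaves at most [k] vertices to the fire. *)
Definition contains b k X : Prop :=
  [/\ s \notin X, forall t, #|ball X t| <= k
    & forall t, #|X :&: nbr (ball X t)| <= b * t.+1].

Lemma ballS X t : ball X t.+1 = ball X t :|: (nbr (ball X t) :\: X).
Proof. by []. Qed.

Lemma ball_mono X t t' : t <= t' -> ball X t \subset ball X t'.
Proof.
move=> /subnK <-; elim: (t' - t) => // d IH.
by rewrite addSn ballS subsetU // IH.
Qed.

Lemma nbr_mono B B' : B \subset B' -> nbr B \subset nbr B'.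
Proof.
move=> sub; apply/subsetP => v; rewrite !inE => /existsP[u /andP[uB euv]].
by apply/existsP; exists u; rewrite (subsetP sub).
Qed.

Lemma start_in_ball X t : s \in ball X t.
Proof. by rewrite (subsetP (ball_mono X (leq0n t))) // inE. Qed.

Lemma ball_antimono X X' t : X \subset X' -> ball X' t \subset ball X t.
Proof.
move=> sub; elim: t => // t IH; rewrite !ballS setUSS //.
by apply: setDSS sub; apply: nbr_mono.
Qed.

Lemma ball_avoid X X' t : [disjoint X' & ball X t] -> ball (X :|: X') t = ball X t.
Proof.
elim: t => // t IH dis; rewrite !ballS IH; last first.
  by apply: disjointWr dis; apply: ball_mono.
apply/setP => v; rewrite !inE; case vB: (v \in ball X t) => //=.
case vX: (v \in X) => //=; case vX': (v \in X') => //=.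
have := disjointFr dis vX'; rewrite ballS !inE vB vX /= => ->.
by [].
Qed.

Lemma card_nbr B : #|nbr B| <= #|B| * max_degree e.
Proof.
have -> : nbr B = \bigcup_(u in B) [set v | e u v].
  apply/setP => v; rewrite inE; apply/existsP/bigcupP.
    by move=> [u /andP[uB euv]]; exists u => //; rewrite inE.
  by move=> [u uB]; rewrite inE => euv; exists u; rewrite uB.
apply: (@leq_trans (\sum_(u in B) #|[set v | e u v]|)).
  elim/big_rec2: _ => [|u m A uB le_m]; first by rewrite cards0.
  by apply: leq_trans (leq_card_setU _ _) _; rewrite leq_add2l.
rewrite -sum_nat_const; apply: leq_sum => u _.
by rewrite /max_degree (bigD1 u) //= leq_maxl.
Qed.

Lemma card_ball X t : #|ball X t| <= (max_degree e).+1 ^ t.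
Proof.
elim: t => [|t IH]; first by rewrite cards1.
rewrite ballS; apply: leq_trans (leq_card_setU _ _) _.
have le1 := subset_leq_card (subsetDl (nbr (ball X t)) X).
have := card_nbr (ball X t); rewrite expnS; nia.
Qed.

(* The distance that the fire has reached after [j] rounds of confinement; each
   round leaves enough time to protect two bags for each vertex at its border. *)
Fixpoint radius (W j : nat) : nat :=
  if j is j'.+1 then
    radius W j' + (2 * W * (max_degree e).+1 ^ (radius W j').+1).+1
  else 0.

Section Containment.
Variables (bags : seq {set 'I_n}) (W : nat).
Hypothesis cover : forall v : 'I_n, exists2 i, i < size bags & v \in nth set0 bags i.
Hypothesis edges : forall u v : 'I_n, e u v ->
  exists2 i, i < size bags & (u \in nth set0 bags i) && (v \in nth set0 bags i).
Hypothesis convex : forall (i j l : nat) (v : 'I_n), i <= j -> j <= l ->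
  v \in nth set0 bags i -> v \in nth set0 bags l -> v \in nth set0 bags j.
Hypothesis first_bag : nth set0 bags 0 = set0.
Hypothesis small : forall i, #|nth set0 bags i| <= W.
Let bag := nth set0 bags.

(* A bag is touched if it contains a vertex at distance between [D] and [D'].
   Protecting the untouched bags nearest to each vertex at distance [D + 1]
   keeps the fire within touched bags, each of which has a vertex in [C]. *)
Lemma containment_round X D N :
  s \notin X -> #|X| <= D -> (forall t, #|X :&: nbr (ball X t)| <= t.+1) ->
  (forall i t, #|bag i :&: (ball X t :\: ball X D)| <= N.+1) ->
  let D' := D + (2 * W * (max_degree e).+1 ^ D.+1).+1 in
  exists X', [/\ s \notin X', #|X'| <= D',
    forall t, #|X' :&: nbr (ball X' t)| <= t.+1
    & forall i t, #|bag i :&: (ball X' t :\: ball X' D')| <= N].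
Proof.
move=> sX cardX sched thin D'.
pose C := ball X D' :\: ball X D.
pose touched i := bag i :&: C != set0.
pose Z := ball X D.+1 :\: ball X D.
have ZC : Z \subset C by apply/setSD/ball_mono; rewrite /D'; lia.
have far z : exists lohi : nat * nat, z \in Z ->
    [/\ ~~ touched lohi.1, ~~ touched lohi.2,
      forall i, lohi.1 < i -> i < lohi.2 -> touched i
      & forall i, z \in bag i -> lohi.1 < i < lohi.2].
  case zZ: (z \in Z); last by exists (0, 0).
  have [j lt_j zj] := cover z.
  have zt i : z \in bag i -> touched i.
    by move=> zi; apply/set0Pn; exists z; rewrite inE zi (subsetP ZC).
  (* Untouched bags exist on both sides: bag 0 is empty, and beyond the end [nth] returns the empty
     set. *)
  have exlo : exists i, (i <= j) && ~~ touched i.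
    by exists 0; rewrite /touched /bag first_bag set0I eqxx.
  have exhi : exists i, (j <= i) && ~~ touched i.
    by exists (size bags); rewrite /touched /bag nth_default // set0I eqxx ltnW.
  have blo i : (i <= j) && ~~ touched i -> i <= j by case/andP.
  case: (ex_maxnP exlo blo) => lo /andP[le_lo ulo] maxlo.
  case: (ex_minnP exhi) => hi /andP[le_hi uhi] minhi.
  exists (lo, hi) => _ /=; split=> //.
    move=> i lt_lo lt_hi; apply: contraT => ui.
    case: (leqP i j) => le_ij.
      by have := maxlo i; rewrite le_ij ui => /(_ isT); lia.
    by have := minhi i; rewrite (ltnW le_ij) ui => /(_ isT); lia.
  move=> i zi; rewrite !ltnNge; apply/andP; split; apply/negP => le_i.
    by move/negP: ulo; apply; apply: zt; apply: (convex le_i le_lo).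
  by move/negP: uhi; apply; apply: zt; apply: (convex le_hi le_i).
have [lohi lohiP] := fin_all_exists far.
pose Y z := bag (lohi z).1 :|: bag (lohi z).2.
(* The vertices taken out here have burnt by time [D] already, as an untouched bag does not meet
   [C]. The others are not reached by time [D'], so protecting them leaves the fire unchanged until
   then. *)
pose X1 := (\bigcup_(z in Z) Y z) :\: ball X D'.
have dis : [disjoint X1 & ball X D'].
  by rewrite /X1 disjoint_sym disjoints_subset setDE setCI setCK subsetUr.
have avoid t : t <= D' -> ball (X :|: X1) t = ball X t.
  by move=> le_t; apply: ball_avoid; apply: disjointWr dis; apply: ball_mono.
have cardX1 : #|X1| <= 2 * W * (max_degree e).+1 ^ D.+1.
  apply: leq_trans (subset_leq_card (subsetDl _ _)) _.
  apply: (@leq_trans (\sum_(z in Z) #|Y z|)).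
    elim/big_rec2: _ => [|u m A uB le_m]; first by rewrite cards0.
    by apply: leq_trans (leq_card_setU _ _) _; rewrite leq_add2l.
  apply: (@leq_trans (\sum_(z in Z) 2 * W)).
    apply: leq_sum => z _; apply: leq_trans (leq_card_setU _ _) _.
    by have := small (lohi z).1; have := small (lohi z).2; rewrite /bag; lia.
  rewrite sum_nat_const mulnC leq_mul2l; apply/orP; right.
  apply: leq_trans (card_ball X D.+1); apply: subset_leq_card; apply: subsetDl.
have cardXX : #|X :|: X1| <= D'.
  by apply: leq_trans (leq_card_setU _ _) _; rewrite /D'; lia.
(* What burns after time [D] is caught between the two bags of some [z]: to get out, the fire would
   have to enter one of these bags at a vertex that is protected, or that burns by time [D'] and so
   makes the bag touched. *)
have between m v : v \in ball (X :|: X1) m -> v \notin ball X D ->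
    exists2 z, z \in Z & forall i, v \in bag i -> (lohi z).1 < i < (lohi z).2.
  elim: m v => [|m IH] v.
    by rewrite inE => /eqP->; rewrite start_in_ball.
  rewrite ballS inE => /orP[/IH //|].
  rewrite !inE negb_or => /andP[/andP[vX vX1] /existsP[u /andP[u_m euv]]] vD.
  case uD: (u \in ball X D).
    have vZ : v \in Z.
      rewrite /Z inE vD ballS !inE vX /=; apply/orP; right.
      by apply/existsP; exists u; rewrite uD.
    by exists v => //; have [] := lohiP v vZ.
  have [|z zZ zP] := IH u u_m; first by rewrite uD.
  exists z => //; have [ulo uhi _ _] := lohiP z zZ.
  have [l lt_l /andP[ul vl]] := edges euv.
  have /andP[lo_l l_hi] := zP l ul.
  have out i : (i == (lohi z).1) || (i == (lohi z).2) -> v \notin bag i.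
    move=> i_eq; apply/negP => vi.
    have ui : ~~ touched i by case/orP: i_eq => /eqP->.
    have vY : v \in Y z by rewrite /Y inE; case/orP: i_eq => /eqP <-; rewrite vi ?orbT.
    case vD': (v \in ball X D').
      by case/negP: ui; apply/set0Pn; exists v; rewrite inE vi /C inE vD' vD.
    by case/negP: vX1; rewrite vD' /=; apply/bigcupP; exists z.
  move=> i vi; rewrite !ltnNge; apply/andP; split; apply/negP => le_i.
    have /negP[] : v \notin bag (lohi z).1 by apply: out; rewrite eqxx.
    by apply: (convex le_i (ltnW lo_l)).
  have /negP[] : v \notin bag (lohi z).2 by apply: out; rewrite eqxx orbT.
  by apply: (convex (ltnW l_hi) le_i).
exists (X :|: X1); split=> //.
- by rewrite !inE start_in_ball orbF.
(* From time [D'] on, the whole set is small enough to have been protected; before that, no vertex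
   of [X1] outside [X] is threatened. *)
- move=> t; case: (ltnP t D') => [lt_t | le_t]; last first.
    apply: leq_trans (subset_leq_card (subsetIl _ _)) _; lia.
  rewrite avoid; last exact: ltnW.
  apply: leq_trans (sched t); apply: subset_leq_card; apply/subsetP => v.
  rewrite inE => /andP[]; rewrite inE => /orP[vX vN|vX1 vN]; first by rewrite inE vX.
  rewrite inE vN andbT; apply: contraT => vX.
  suff : v \in ball X D' by rewrite (disjointFr dis vX1).
  by apply: (subsetP (ball_mono X lt_t)); rewrite ballS inE inE vX vN orbT.
(* A bag in which something burns after [D'] lies strictly between the two bags of some [z] and so
   is touched. Its vertex in [C] is counted after [D] but not after [D']. *)
- move=> i t; rewrite (avoid D') //.
  set A := _ :&: _; case: (posnP #|A|) => [-> //|]; rewrite card_gt0 => /set0Pn[v].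
  rewrite inE => /andP[vi]; rewrite inE => /andP[vD' vt].
  have [|z zZ zP] := between t v vt.
    by apply: contra vD'; apply: (subsetP (ball_mono X _)); rewrite /D'; lia.
  have [_ _ tz _] := lohiP z zZ; have /andP[lo hi] := zP i vi.
  have /set0Pn[c] := tz i lo hi; rewrite !inE => /andP[ci /andP[cD cD']].
  rewrite -ltnS; apply: leq_trans (thin i (maxn t D')); apply: proper_card.
  apply/properP; split.
    apply/subsetP => x; rewrite !inE => /andP[-> /andP[xD' xt]] /=; apply/andP; split.
      by apply: contra xD'; apply: (subsetP (ball_mono X _)); rewrite /D'; lia.
    apply: (subsetP (ball_mono X (leq_maxl t D'))).
    by apply: (subsetP (ball_antimono t (subsetUl X X1))).
  exists c; last by rewrite !inE cD' !andbF.
  by rewrite inE ci inE cD (subsetP (ball_mono X (leq_maxr t D'))).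
Qed.

(** Each round lowers by one the bound on the number of vertices of a bag that burn after the
    current radius; it starts at [W]. Once it is 0 nothing burns any more, because the bags cover
    all vertices. *)
Lemma containment_from_bags : exists X, contains 1 ((max_degree e).+1 ^ radius W W) X.
Proof.
have stage j : j <= W -> exists X, [/\ s \notin X, #|X| <= radius W j,
    forall t, #|X :&: nbr (ball X t)| <= t.+1
    & forall i t, #|bag i :&: (ball X t :\: ball X (radius W j))| <= W - j].
  elim: j => [|j IH] le_j.
    exists set0; split=> [||t|i t]; rewrite ?inE ?cards0 //.
      by rewrite set0I cards0.
    rewrite subn0; apply: leq_trans (small i); apply: subset_leq_card; apply: subsetIl.
  have [X [sX cX sched thin]] := IH (ltnW le_j).
  by apply: containment_round sX cX sched _; rewrite -subSn.
have [X [sX cX sched thin]] := stage W (leqnn W).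
exists X; split=> // t; last by rewrite mul1n.
apply: leq_trans (card_ball X (radius W W)); apply: subset_leq_card.
apply/subsetP => v vt; apply/negPn/negP => vD.
have [i lt_i vi] := cover v; have := thin i t; rewrite subnn leqn0 cards_eq0.
by move/eqP/setP/(_ v); rewrite !inE vi vD vt.
Qed.

End Containment.

Theorem containment p : pathwidth_le e p ->
  exists X, contains 1 ((max_degree e).+1 ^ radius p.+1 p.+1) X.
Proof.
move=> [bags [[cover edges convex] small]].
(* The empty bag in front guarantees an untouched bag to the left of every vertex. *)
apply: (@containment_from_bags (set0 :: bags)) => //.
- move=> v; have [X Xb vX] := cover v.
  by exists (index X bags).+1; rewrite /= ?nth_index // ltnS index_mem.
- move=> u v /edges[X Xb uvX].
  by exists (index X bags).+1; rewrite /= ?nth_index // ltnS index_mem.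
- move=> i j l v; case: (ltnP l (size bags).+1) => [|le_l]; last first.
    by move=> _ _ _; rewrite (@nth_default _ set0 (set0 :: bags) l le_l) inE.
  case: i => [|i] /=; first by rewrite inE.
  by case: j => // j; case: l => // l lt_l le_ij le_jl; apply: convex.
- case=> [|i] /=; first by rewrite cards0.
  case: (ltnP i (size bags)) => [lt_i|le_i]; first by rewrite small ?mem_nth.
  by rewrite nth_default ?cards0.
Qed.

End Fire.

(** * From protection strategies to containing sets *)

Section Strategy.
Variables (n : nat) (e : rel 'I_n) (s : 'I_n) (b : nat) (strat : nat -> {set 'I_n}).
Let burned t := (ff_state e s strat t).1.
Let protected t := (ff_state e s strat t).2.

Lemma protectedS t : protected t.+1 = protected t :|: strat t.+1.
Proof. by rewrite /protected /=; case: ff_state. Qed.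

Lemma burnedS t :
  burned t.+1 = burned t :|: (nbr e (burned t) :\: protected t.+1).
Proof.
rewrite /burned /protected /=; case: ff_state => B P /=.
by apply/setP => v; rewrite !inE.
Qed.

Lemma burned_mono t t' : t <= t' -> burned t \subset burned t'.
Proof.
move=> /subnK <-; elim: (t' - t) => // d IH.
by rewrite addSn burnedS subsetU // IH.
Qed.

Lemma protected_mono t t' : t <= t' -> protected t \subset protected t'.
Proof.
move=> /subnK <-; elim: (t' - t) => // d IH.
by rewrite addSn protectedS subsetU // IH.
Qed.

Hypothesis valid : valid_strategy e s b strat.

Lemma card_protected t : #|protected t| <= b * t.
Proof.
elim: t => [|t IH]; first by rewrite cards0.
rewrite protectedS; apply: leq_trans (leq_card_setU _ _) _.
by have [le_b _] := @valid t.+1 isT; rewrite mulnS addnC leq_add.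
Qed.

Lemma burned_unprotected t v : v \in burned t -> v \notin protected t.
Proof.
elim: t v => [|t IH] v; first by rewrite !inE.
rewrite burnedS protectedS !inE => /orP[vB | /andP[]//].
rewrite negb_or IH //; have [_ dis] := @valid t.+1 isT.
by rewrite (disjointFl dis vB).
Qed.

Lemma burned_stabilizes : exists T, forall t, burned t \subset burned T.
Proof.
suff from d T : n - #|burned T| <= d -> exists T, forall t, burned t \subset burned T.
  exact: (from _ 0 (leqnn _)).
elim: d T => [|d IH] T le_d.
  exists T => t; suff -> : burned T = setT by apply: subsetT.
  apply/eqP; rewrite eqEcard subsetT cardsT card_ord.
  by move: le_d; rewrite leqn0 subn_eq0.
case: (classic (exists t, ~~ (burned t \subset burned T))) => [[t not_sub]|none_out].
  apply: (IH (maxn t T)).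
  have : #|burned T| < #|burned (maxn t T)|.
    apply: proper_card; rewrite properE burned_mono ?leq_maxr //=.
    apply: contra not_sub => sub; apply: subset_trans sub.
    by apply: burned_mono; rewrite leq_maxl.
  lia.
by exists T => t; apply: contraT => out; case: none_out; exists t.
Qed.

(** [X] consists of all vertices that never burn. One of them that is adjacent to the fire must be
    protected in the coming step at the latest, so their number is bounded by the budget received
    until then. *)
Lemma contains_of_strategy k : (forall t, #|burned t| <= k) ->
  exists X, contains e s b k X.
Proof.
move=> le_k; have [T BT] := burned_stabilizes.
have never t v : v \in burned T -> v \notin protected t.
  move=> vT; have vm := subsetP (burned_mono (leq_maxr t T)) v vT.
  apply: contra (burned_unprotected vm); apply: subsetP.
  by apply: protected_mono; rewrite leq_maxl.
have sub t : ball e s (~: burned T) t \subset burned t.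
  elim: t => // t IH; rewrite ballS burnedS.
  apply: (subset_trans (setSU _ IH)); apply: setUS; apply/subsetP => v.
  rewrite !inE negbK => /andP[vT vN]; rewrite (never t.+1 v vT) /=.
  by have := subsetP (nbr_mono e IH) v; rewrite !inE; apply.
exists (~: burned T); split=> [|t|t].
- by rewrite inE negbK (subsetP (BT 0)) // inE.
- by apply: leq_trans (le_k t); apply/subset_leq_card/sub.
- apply: leq_trans (card_protected t.+1); apply: subset_leq_card.
  apply/subsetP => v /setIP[]; rewrite inE => vT vN.
  have vN' := subsetP (nbr_mono e (sub t)) v vN.
  apply: contraT => vP; case/negP: vT; apply: (subsetP (BT t.+1)).
  by rewrite burnedS inE inE vP vN' orbT.
Qed.

End Strategy.

(** * Simulating the fire along a sequence of decisions *)

(* [found], [burnt] and [saved] are ghost fields listing vertices in the order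
   of their discovery; [short] records that the decisions were used up. *)
Record sim := Sim {
  seen : track; active : track; pending : track;
  budget : nat; quota : nat;
  found : seq nat; burnt : seq nat; saved : seq nat;
  failed : bool; short : bool }.

Lemma iteriP (T : Type) (P : nat -> T -> Prop) (f : nat -> T -> T) m x :
  P 0 x -> (forall i y, i < m -> P i y -> P i.+1 (f i y)) -> P m (iteri m f x).
Proof.
move=> P0; elim: m => // m IH PS; apply: (PS) => //; apply: IH => i y lt_i.
by apply: PS; apply: leqW.
Qed.

Lemma iteri_agree (T : Type) (P : T -> Prop) (f g : nat -> T -> T) m x :
  (forall i y, i < m -> P (f i y) -> P y /\ f i y = g i y) ->
  P (iteri m f x) -> P x /\ iteri m f x = iteri m g x.
Proof.
elim: m => // m IH back /= Pm; have [Px eq_m] := back _ _ (ltnSn m) Pm.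
have [Px0 <-] := IH (fun i y lt_i => back i y (leqW lt_i)) Px.
by split.
Qed.

Section Simulation.
Variables (E : nat -> nat -> bool) (n s b k : nat).

Section Decisions.
Variables (dec : nat -> nat -> bool) (L : nat).

Definition set_at (f : track) (x : nat) (v : bool) : track :=
  fun y => if y == x then v else f y.

(** [dec] receives the number of the decision and the vertex, so that the same simulation can follow
    a sequence of bits or a given set of vertices to save. A failure is merely recorded; the run
    goes on. *)
Definition discover (v : nat) (st : sim) : sim :=
  let: Sim se ac pe bu qu fo bs sa fa sh := st in
  let se' := set_at se v true in
  let fo' := rcons fo v in
  if size fo == L then Sim se ac pe bu qu fo bs sa true true else
  if dec (size fo) v then
    if qu is qu'.+1 then Sim se' ac (set_at pe v true) bu qu' fo' (rcons bs v) sa fa sh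
    else Sim se' ac pe bu qu fo' bs sa true sh
  else
    if bu is bu'.+1 then Sim se' ac pe bu' qu fo' bs (rcons sa v) fa sh
    else Sim se' ac pe bu qu fo' bs sa true sh.

Definition visit (u v : nat) (st : sim) : sim :=
  if [&& E u v, active st u & ~~ seen st v] then discover v st else st.

Definition refill (st : sim) : sim :=
  let: Sim se ac pe bu qu fo bs sa fa sh := st in
  Sim se ac pe (bu + b) qu fo bs sa fa sh.

(** Restricted to cells below [n], as in the loop of the program; with [n] replaced by the loop
    index it becomes the invariant of that loop. *)
Definition advance (st : sim) : sim :=
  let: Sim se ac pe bu qu fo bs sa fa sh := st in
  Sim se (fun x => if x < n then pe x else ac x) (fun x => (n <= x) && pe x)
    bu qu fo bs sa fa sh.

Definition scan_row (u m : nat) (st : sim) : sim := iteri m (visit u) st.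
Definition scan (m : nat) (st : sim) : sim := iteri m (fun u => scan_row u n) st.
Definition layer (st : sim) : sim := advance (scan n (refill st)).

Definition start : sim :=
  Sim (mark s) (mark s) none 0 k.-1 [::] [:: s] [::] false false.

Definition simulate (m : nat) : sim := iteri m (fun _ => layer) start.

End Decisions.

(** [P] is inherited by all earlier states, so that a fact about the final state, such as not being
    short of decisions, is available at every discovery. *)
Lemma simulate_agree (P : sim -> Prop) (d1 d2 : nat -> nat -> bool) L1 L2 m :
  (forall st, P (advance st) -> P st) -> (forall st, P (refill st) -> P st) ->
  (forall v st, P (discover d1 L1 v st) ->
     P st /\ discover d1 L1 v st = discover d2 L2 v st) ->
  P (simulate d1 L1 m) -> simulate d1 L1 m = simulate d2 L2 m.
Proof.
move=> Padv Pref Pdis Pm.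
have layers y : P (layer d1 L1 y) -> P y /\ layer d1 L1 y = layer d2 L2 y.
  move=> /Padv; rewrite /layer /scan => Ps.
  have rows u z : P (scan_row d1 L1 u n z) ->
      P z /\ scan_row d1 L1 u n z = scan_row d2 L2 u n z.
    apply: iteri_agree => v x _.
    by rewrite /visit; case: ifP => // _; apply: Pdis.
  by have [/Pref Py <-] := iteri_agree (fun u z _ => rows u z) Ps.
exact: (proj2 (iteri_agree (fun _ y _ => layers y) Pm)).
Qed.

Record coherent (L D : nat) (st : sim) : Prop := Coherent {
  inv_uniq : uniq (s :: found st);
  inv_lt : forall v, v \in s :: found st -> v < n;
  inv_seen : forall v, seen st v = (v \in s :: found st);
  inv_burnt : {subset burnt st <= s :: found st};
  inv_saved : {subset saved st <= found st};
  inv_disj : forall v, v \in saved st -> v \notin burnt st;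
  inv_uniq_burnt : uniq (burnt st);
  inv_uniq_saved : uniq (saved st);
  inv_start : s \in burnt st;
  inv_quota : size (burnt st) + quota st = k;
  inv_active : forall v, active st v -> v \in burnt st;
  inv_pending : forall v, pending st v -> v \in burnt st;
  inv_found : forall v, v \in found st -> exists2 u, u \in burnt st & E u v;
  inv_size : size (found st) <= L;
  inv_short : short st -> L < k * D }.

Variable D : nat.
Hypothesis degree : forall u, u < n -> count (E u) (iota 0 n) <= D.
Hypotheses (s_lt : s < n) (k_gt0 : 0 < k).

Lemma size_neighbours (us vs : seq nat) :
  (forall u, u \in us -> u < n) -> (forall v, v \in vs -> v < n) -> uniq vs ->
  (forall v, v \in vs -> exists2 u, u \in us & E u v) -> size vs <= size us * D.
Proof.
move=> us_lt vs_lt uniq_vs adj.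
apply: (@leq_trans (size (flatten [seq [seq v <- iota 0 n | E u v] | u <- us]))).
  apply: uniq_leq_size => // v vin; have [u uin Euv] := adj v vin.
  apply/flattenP; exists [seq v <- iota 0 n | E u v]; first by apply: map_f.
  by rewrite mem_filter Euv mem_iota vs_lt.
elim: us us_lt {adj} => // u us IH us_lt /=; rewrite size_cat mulSn leq_add //.
  by rewrite size_filter degree // us_lt ?mem_head.
by apply: IH => u' u'in; rewrite us_lt // inE u'in orbT.
Qed.

Section Invariants.
Variables (dec : nat -> nat -> bool) (L : nat).

Lemma inv_start_state : coherent L D start.
Proof.
split=> //=.
- by move=> v; rewrite inE => /eqP->.
- by move=> v; rewrite inE.
- exact: mem_head.
- by rewrite add1n prednK.
- by move=> v; rewrite inE.
Qed.

(** All vertices found so far and the new one are distinct neighbours of burnt vertices. This bounds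
    the number of decisions by the number of burnt vertices, even in a run that has failed. *)
Lemma new_vertex_bound u v st : v < n -> coherent L D st ->
  active st u -> E u v -> ~~ seen st v -> size (found st) < size (burnt st) * D.
Proof.
move=> lt_v I act_u Euv new_v; rewrite -(size_rcons _ v).
have v_new : v \notin s :: found st by rewrite -(inv_seen I).
apply: size_neighbours.
- by move=> w /(inv_burnt I); apply: (inv_lt I).
- move=> w; rewrite mem_rcons inE => /orP[/eqP-> // | wf].
  by apply: (inv_lt I); rewrite inE wf orbT.
- have := inv_uniq I; rewrite rcons_uniq /= => /andP[_ ->].
  by move: v_new; rewrite inE negb_or => /andP[_ ->].
- move=> w; rewrite mem_rcons inE => /orP[/eqP-> | /(inv_found I)//].
  by exists u => //; apply: (inv_active I).
Qed.

Lemma inv_visit u v st : u < n -> v < n -> coherent L D st -> coherent L D (visit dec L u v st).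
Proof.
move=> lt_u lt_v I; rewrite /visit; case: ifP => // /and3P[Euv act_u new_v].
have u_burnt := inv_active I act_u.
have v_new : v \notin s :: found st by rewrite -(inv_seen I).
have v_unburnt : v \notin burnt st.
  by apply: contra v_new; apply: (inv_burnt I).
have v_unsaved : v \notin saved st.
  by apply: contra v_new => vs; rewrite inE (inv_saved I vs) orbT.
have bound := new_vertex_bound lt_v I act_u Euv new_v.
have uniq' : uniq (s :: rcons (found st) v).
  by rewrite -rcons_cons rcons_uniq v_new (inv_uniq I).
have lt' w : w \in s :: rcons (found st) v -> w < n.
  by rewrite -rcons_cons mem_rcons inE => /orP[/eqP-> // | /(inv_lt I)].
case: I => [_ _ I3 I4 I5 I6 I7 I8 I9 I10 I11 I12 I13 I14 I15].
have seen' w : set_at (seen st) v true w = (w \in s :: rcons (found st) v).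
  by rewrite -rcons_cons mem_rcons inE /set_at I3; case: eqP.
have burnt' : {subset burnt st <= s :: rcons (found st) v}.
  by move=> w /I4; rewrite -rcons_cons mem_rcons inE => ->; rewrite orbT.
have saved' : {subset saved st <= rcons (found st) v}.
  by move=> w /I5; rewrite mem_rcons inE => ->; rewrite orbT.
have found' bs : {subset burnt st <= bs} ->
    forall w, w \in rcons (found st) v -> exists2 u0, u0 \in bs & E u0 w.
  move=> sub w; rewrite mem_rcons inE => /orP[/eqP->|/I13[u0 ? ?]].
    by exists u => //; apply: sub.
  by exists u0 => //; apply: sub.
have adj : size (rcons (found st) v) <= k * D.
  rewrite size_rcons (leq_trans bound) // leq_mul2r.
  by have /= <- := I10; rewrite leq_addr orbT.
rewrite size_rcons in adj; clear bound.
case: st => se ac pe bu qu fo bs sa fa sh /= in I3 I4 I5 I6 I7 I8 I9 I10 I11 I12 I13 I14 I15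
  act_u new_v u_burnt v_new v_unburnt v_unsaved uniq' lt' seen' burnt' saved' found' adj *.
case: eqP => [eq_L|/eqP ne_L].
  split=> //=; [ | | by rewrite -eq_L].
    case/andP: uniq'; rewrite rcons_uniq mem_rcons inE negb_or.
    by move=> /andP[_ ->] /andP[_ ->].
  by move=> w wi; apply: lt'; rewrite -rcons_cons mem_rcons inE wi orbT.
have size' : size (rcons fo v) <= L by rewrite size_rcons ltn_neqAle ne_L.
case: (dec _ v).
  case: qu I10 => [|qu] I10; first by split=> //=; apply: found'.
  split=> //=.
  - move=> w; rewrite mem_rcons inE => /orP[/eqP->|/burnt' //].
    by rewrite -rcons_cons mem_rcons mem_head.
  - move=> w ws; rewrite mem_rcons inE negb_or I6 // andbT.
    by apply: contraNneq v_unsaved => <-.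
  - by rewrite rcons_uniq v_unburnt.
  - by rewrite mem_rcons inE I9 orbT.
  - by rewrite size_rcons; lia.
  - by move=> w /I11 ?; rewrite mem_rcons inE orbC; apply/orP; left.
  - move=> w; rewrite /set_at mem_rcons inE; case: eqP => //= _; exact: I12.
  - by apply: found' => w wi; rewrite mem_rcons inE wi orbT.
case: bu => [|bu]; first by split=> //=; apply: found'.
split=> //=; last exact: found'.
- by move=> w; rewrite mem_rcons inE => /orP[/eqP->|/saved' //]; rewrite mem_rcons mem_head.
- by move=> w; rewrite mem_rcons inE => /orP[/eqP-> // | /I6].
- by rewrite rcons_uniq v_unsaved.
Qed.

Lemma inv_refill st : coherent L D st -> coherent L D (refill st).
Proof. by case: st => ? ? ? ? ? ? ? ? ? ? []. Qed.

Lemma inv_advance st : coherent L D st -> coherent L D (advance st).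
Proof.
case: st => ? ? ? ? ? ? ? ? ? ? [? ? ? ? ? ? ? ? ? ? I11 I12 ? ? ?]; split=> //= v.
  by case: ifP => _; [apply: I12 | apply: I11].
by move=> /andP[_]; apply: I12.
Qed.

Lemma inv_scan_row u m st : u < n -> m <= n ->
  coherent L D st -> coherent L D (scan_row dec L u m st).
Proof.
move=> lt_u le_m I; apply: (iteriP (P := fun _ => coherent L D)) => // v y lt_v.
by apply: inv_visit => //; apply: leq_trans le_m.
Qed.

Lemma inv_scan m st : m <= n -> coherent L D st -> coherent L D (scan dec L m st).
Proof.
move=> le_m I; apply: (iteriP (P := fun _ => coherent L D)) => // u y lt_u.
by apply: inv_scan_row => //; apply: leq_trans le_m.
Qed.

Lemma inv_simulate m : coherent L D (simulate dec L m).
Proof.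
apply: (iteriP (P := fun _ => coherent L D)) => [|_ y _ Iy]; first exact: inv_start_state.
by apply/inv_advance/inv_scan/inv_refill.
Qed.

End Invariants.

(** Carries the failure of all sequences of one length over to longer ones, provided that no run was
    short of bits. *)
Lemma simulate_enough d1 d2 L1 L2 m :
  L1 <= L2 -> (forall i v, i < L1 -> d1 i v = d2 i v) ->
  ~~ short (simulate d1 L1 m) -> simulate d1 L1 m = simulate d2 L2 m.
Proof.
move=> le_L eq_d ns.
apply: (simulate_agree (P := fun st => ~~ short st /\ size (found st) <= L1)).
- by case.
- by case.
- move=> v [se ac pe bu qu fo bs sa fa sh]; rewrite /discover.
  case: ifP => [_ []//|/eqP ne_L] Pst.
  have [ns' lt_fo] : ~~ sh /\ size fo < L1.
    by move: Pst; case: (d1 _ v); [case: qu => [|qu] | case: bu => [|bu]];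
       rewrite /= size_rcons; case.
  split; first by split=> //; apply: ltnW.
  by rewrite eq_d // [RHS]ifN // neq_ltn (leq_trans lt_fo).
- by split=> //; apply: inv_size (inv_simulate d1 L1 m).
Qed.

(** Only the decisions on vertices actually found matter; thus a rule that depends on the vertex can
    be replaced by the sequence of its outcomes. *)
Lemma simulate_found d1 d2 L m :
  (forall i, i < size (found (simulate d1 L m)) ->
     forall v, d1 i (nth 0 (found (simulate d1 L m)) i) = d2 i v) ->
  simulate d1 L m = simulate d2 L m.
Proof.
set fs := found _ => eq_d.
apply: (simulate_agree (P := fun st => prefix (found st) fs)); last exact: prefix_refl.
- by case.
- by case.
move=> v [se ac pe bu qu fo bs sa fa sh]; rewrite /discover.
case: ifP => [_ -> //|_] Pst.
have pre : prefix (rcons fo v) fs.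
  by move: Pst; case: (d1 _ v); [case: qu => [|qu] | case: bu => [|bu]].
split; first by apply: prefix_trans pre; apply: prefix_rcons.
have [t fs_eq] := prefixP pre.
by rewrite -(eq_d _ _ v) fs_eq ?size_cat ?size_rcons ?nth_cat ?size_rcons ?leqnn
  ?nth_rcons ?ltnn ?eqxx //; lia.
Qed.
End Simulation.

(** * Successful decision sequences and winning strategies *)

Section Correctness.
Variables (n : nat) (e : rel 'I_n) (s : 'I_n) (E : nat -> nat -> bool) (b k : nat).
Hypothesis EE : forall i j : 'I_n, E i j = e i j.
Hypothesis k_gt0 : 0 < k.
Let D := max_degree e.

Definition verts (B : {set 'I_n}) : seq nat := [seq val i | i <- enum B].

Lemma size_verts B : size (verts B) = #|B|.
Proof. by rewrite size_map -cardE. Qed.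

Lemma mem_verts (B : {set 'I_n}) (i : 'I_n) : (val i \in verts B) = (i \in B).
Proof. by rewrite mem_map ?mem_enum //; apply: val_inj. Qed.

Lemma uniq_verts B : uniq (verts B).
Proof. by rewrite map_inj_uniq ?enum_uniq //; apply: val_inj. Qed.

Lemma verts_sub (A B : {set 'I_n}) : A \subset B -> {subset verts A <= verts B}.
Proof.
move=> sub x /mapP[i]; rewrite mem_enum => iA ->.
by rewrite mem_verts (subsetP sub).
Qed.

Lemma uniq_verts_bound (vs : seq nat) B : uniq vs -> {subset vs <= verts B} ->
  size vs <= #|B|.
Proof. by move=> us sub; rewrite -size_verts; apply: uniq_leq_size. Qed.

Lemma degree_bound u : u < n -> count (E u) (iota 0 n) <= D.
Proof.
move=> lt_u; rewrite -size_filter; set i := Ordinal lt_u.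
apply: (@leq_trans #|[set v | e i v]|); last first.
  by rewrite /D /max_degree (bigD1 i) //= leq_maxl.
apply: uniq_verts_bound => [|v]; first by rewrite filter_uniq ?iota_uniq.
rewrite mem_filter mem_iota => /andP[Euv lt_v].
by rewrite -[v]/(val (Ordinal lt_v)) mem_verts inE -EE.
Qed.

Notation coherent := (coherent E n s k).

Section Guided.
Variables (X : {set 'I_n}) (g L : nat).
Hypotheses (X_contains : contains e s b g X) (g_le : g <= k) (gL : g * D <= L).

Let guide (i v : nat) := v \notin verts X.

(** [d] is 1 within a layer, once the budget has been refilled, and 0 between layers. *)
Record guided (t d : nat) (st : sim) : Prop := Guided {
  gd_inv : coherent L D st;
  gd_ok : ~~ failed st;
  gd_budget : size (saved st) + budget st = b * (t + d);
  gd_burnt : {subset burnt st <= verts (ball e s X (t + d))};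
  gd_active : forall v, active st v -> v \in verts (ball e s X t);
  gd_saved : {subset saved st <= verts (X :&: nbr e (ball e s X t))} }.

(** None of the three resources runs out. Decisions: at most [g] vertices burn, so at most [g * D]
    are found. Quota: burnt vertices stay within the ball of [X]. Budget: saved vertices are
    threatened vertices of [X], which [contains] bounds by the budget received. *)
Lemma guided_visit t u v st : u < n -> v < n ->
  guided t 1 st -> guided t 1 (visit E guide L u v st).
Proof.
move=> lt_u lt_v [I ok bu_eq bs_sub ac_sub sa_sub]; have [sX le_g sched] := X_contains.
have I' := inv_visit degree_bound (ltn_ord s) k_gt0 guide lt_u lt_v I.
move: I'; rewrite /visit; case: ifP => // /and3P[Euv act_u new_v] I'.
have v_new : v \notin val s :: found st by rewrite -(inv_seen I).
have v_unburnt : v \notin burnt st.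
  by apply: contra v_new; apply: (inv_burnt I).
have v_unsaved : v \notin saved st.
  by apply: contra v_new => vs; rewrite inE (inv_saved I vs) orbT.
have bound := new_vertex_bound degree_bound lt_v I act_u Euv new_v.
have cardb : size (burnt st) <= g.
  by apply: leq_trans (le_g (t + 1)); apply: uniq_verts_bound => //; apply: inv_uniq_burnt I.
have lt_L : size (found st) < L.
  by apply: leq_trans bound (leq_trans _ gL); rewrite leq_mul2r cardb orbT.
pose iv := Ordinal lt_v; pose iu := Ordinal lt_u.
have v_nbr : iv \in nbr e (ball e s X t).
  rewrite inE; apply/existsP; exists iu; rewrite -EE Euv andbT.
  by rewrite -mem_verts; apply: ac_sub.
have v_ball : v \notin verts X -> v \in verts (ball e s X (t + 1)).
  move=> vX; rewrite -[v]/(val iv) mem_verts addn1 ballS !inE -(mem_verts X) vX.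
  by move: v_nbr; rewrite !inE => ->; rewrite orbT.
have burn_ok : v \notin verts X -> size (burnt st) < k.
  move=> vX; apply: leq_trans (leq_trans (le_g (t + 1)) g_le).
  rewrite -(size_rcons _ v); apply: uniq_verts_bound.
    by rewrite rcons_uniq v_unburnt (inv_uniq_burnt I).
  by move=> w; rewrite mem_rcons inE => /orP[/eqP->|]; [apply: v_ball|apply: bs_sub].
have v_save : v \in verts X -> v \in verts (X :&: nbr e (ball e s X t)).
  by move=> vX; rewrite -[v]/(val iv) mem_verts inE -mem_verts vX.
have save_ok : v \in verts X -> size (saved st) < b * (t + 1).
  move=> vX; rewrite addn1; apply: leq_trans (sched t).
  rewrite -(size_rcons _ v); apply: uniq_verts_bound.
    by rewrite rcons_uniq v_unsaved (inv_uniq_saved I).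
  by move=> w; rewrite mem_rcons inE => /orP[/eqP->|]; [apply: v_save|apply: sa_sub].
have q_eq := inv_quota I.
case: st {I v_new new_v bound v_unburnt v_unsaved} ok bu_eq bs_sub ac_sub sa_sub
  act_u cardb lt_L burn_ok save_ok q_eq I' => se ac pe bu qu fo bs sa fa sh /=.
move=> ok bu_eq bs_sub ac_sub sa_sub act_u cardb lt_L burn_ok save_ok q_eq.
rewrite ifN ?neq_ltn ?lt_L // /guide; case: ifP => [vX|/negbFE vX].
  case: qu q_eq => [|qu] q_eq I'; first by have := burn_ok vX; lia.
  split=> //= w; rewrite mem_rcons inE => /orP[/eqP->|]; [exact: v_ball|exact: bs_sub].
case: bu bu_eq => [|bu] bu_eq I'; first by have := save_ok vX; lia.
split=> //=; first by rewrite size_rcons; lia.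
by move=> w; rewrite mem_rcons inE => /orP[/eqP->|]; [apply: v_save|apply: sa_sub].
Qed.

Lemma guided_refill t st : guided t 0 st -> guided t 1 (refill b st).
Proof.
case=> I; have := inv_refill b I; case: st {I} => se ac pe bu qu fo bs sa fa sh I.
rewrite /= => ok bu_eq bs_sub ac_sub sa_sub; split=> //=; first lia.
by move=> w /bs_sub; apply: verts_sub; apply: ball_mono; lia.
Qed.

Lemma guided_advance t st : guided t 1 st -> guided t.+1 0 (advance n st).
Proof.
case=> I; have I' := inv_advance I.
case: st I I' => se ac pe bu qu fo bs sa fa sh I I'.
rewrite /= addn1 => ok bu_eq bs_sub ac_sub sa_sub; split; rewrite ?addn0 //=.
- by move=> v /(inv_active I')/bs_sub.
- by move=> w /sa_sub; apply: verts_sub; apply: setIS; apply: nbr_mono; apply: subsetUl.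
Qed.

Lemma guided_simulate m : guided m 0 (simulate E n s b k guide L m).
Proof.
apply: (iteriP (P := fun t => guided t 0)) => [|t y _ Gy].
  split=> //=; first exact: inv_start_state.
  - by rewrite muln0.
  - by move=> v; rewrite inE => /eqP->; rewrite mem_verts inE.
  - by move=> v /eqP->; rewrite mem_verts inE.
apply: guided_advance; apply: (iteriP (P := fun _ => guided t 1)).
  exact: guided_refill.
move=> u z lt_u Gz; apply: (iteriP (P := fun _ => guided t 1)) => // v x lt_v.
exact: guided_visit.
Qed.

Lemma decisions_exist : exists2 m, m < 2 ^ L &
  ~~ failed (simulate E n s b k (fun i _ => testbit m i) L n).
Proof.
have [I ok _ bs_sub _ _] := guided_simulate n.
set fs := found (simulate E n s b k guide L n).
exists (bits_val L (fun i => nth 0 fs i \notin verts X)); first exact: bits_val_lt.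
rewrite -(@simulate_found E n s b k (ltn_ord s) k_gt0 guide) // => i lt_i v.
by rewrite testbit_bits_val /guide (leq_trans lt_i) ?(inv_size I).
Qed.

End Guided.

Section Played.
Variables (dec : nat -> nat -> bool) (L : nat).
Notation state := (simulate E n s b k dec L).

(* What a layer has done so far, starting from the state [st0]. *)
Record extends (st0 st : sim) : Prop := Extends {
  ex_inv : coherent L D st;
  ex_active : active st = active st0;
  ex_seen : forall v, seen st0 v -> seen st v;
  ex_failed : ~~ failed st -> ~~ failed st0;
  ex_saved : prefix (saved st0) (saved st);
  ex_burnt : {subset burnt st0 <= burnt st};
  ex_budget : ~~ failed st ->
    size (saved st) + budget st = size (saved st0) + budget st0;
  ex_pending : ~~ failed st -> forall v,
    pending st v = (v \in burnt st) && (v \notin burnt st0);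
  ex_cause : forall v, pending st v -> exists u, active st0 u;
  ex_found : ~~ failed st -> forall v, v \in found st ->
    (v \in burnt st) || (v \in saved st) }.

Lemma extends_visit st0 st u v : u < n -> v < n ->
  {subset burnt st0 <= val s :: found st} ->
  extends st0 st -> extends st0 (visit E dec L u v st).
Proof.
move=> lt_u lt_v old [I ac_eq se_sub fa_sub sa_pre bs_sub bu_eq pe_eq cause fo_sub].
have I' := inv_visit degree_bound (ltn_ord s) k_gt0 dec lt_u lt_v I.
move: I'; rewrite /visit; case: ifP => // /and3P[Euv act_u new_v] I'.
have v_old : v \notin burnt st0.
  by apply: contra new_v => /old; rewrite (inv_seen I).
have v_new : v \notin val s :: found st by rewrite -(inv_seen I).
case: st {I Euv new_v} ac_eq se_sub fa_sub sa_pre bs_sub bu_eq pe_eq cause fo_sub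
  act_u I' {old v_new} => se ac pe bu qu fo bs sa fa sh /= -> se_sub fa_sub sa_pre
  bs_sub bu_eq pe_eq cause fo_sub act_u.
have se_sub' w : seen st0 w -> set_at se v true w.
  by rewrite /set_at; case: eqP => // _; apply: se_sub.
case: ifP => [_ I'|_]; first by split.
case: (dec _ _).
  case: qu => [|qu] I'; first by split.
  split=> //=.
  - by move=> w wb; rewrite mem_rcons inE bs_sub ?orbT.
  - move=> ok w; rewrite /set_at mem_rcons inE pe_eq //.
    by case: eqP => //= ->; rewrite v_old.
  - by move=> w; rewrite /set_at; case: eqP => [_ _|_ /cause//]; exists u.
  - move=> ok w; rewrite !mem_rcons !inE => /orP[-> //|/fo_sub].
    by move/(_ ok)/orP=> [->|->]; rewrite ?orbT.
case: bu bu_eq => [|bu] bu_eq I'; first by split.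
split=> //=.
- by apply: prefix_trans sa_pre (prefix_rcons _ _).
- by move=> ok; rewrite size_rcons -bu_eq //; lia.
- move=> ok w; rewrite !mem_rcons !inE => /orP[->|/fo_sub]; first by rewrite orbT.
  by move/(_ ok)/orP=> [->|->]; rewrite ?orbT.
Qed.

Lemma extends_scan st0 m : m <= n -> {subset burnt st0 <= val s :: found st0} ->
  extends st0 st0 -> extends st0 (scan E n dec L m st0) /\
  (~~ failed (scan E n dec L m st0) -> forall u v, u < m -> v < n ->
     active st0 u -> E u v -> seen (scan E n dec L m st0) v).
Proof.
move=> le_m old ex0.
have old' st : extends st0 st -> {subset burnt st0 <= val s :: found st}.
  by move=> ex w wb; rewrite -(inv_seen (ex_inv ex)) (ex_seen ex) // (inv_seen (ex_inv ex0)) old.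
apply: (iteriP (P := fun m st => extends st0 st /\ (~~ failed st ->
   forall u v, u < m -> v < n -> active st0 u -> E u v -> seen st v))) => //.
move=> u st lt_u [ex cov]; have lt_un := leq_trans lt_u le_m.
suff [ex' mono cov'] : [/\ extends st0 (scan_row E dec L u n st),
    forall v, seen st v -> seen (scan_row E dec L u n st) v &
    ~~ failed (scan_row E dec L u n st) -> ~~ failed st /\ forall v, v < n ->
      active st0 u -> E u v -> seen (scan_row E dec L u n st) v].
  split=> // /cov'[ok rows] u' v; rewrite ltnS leq_eqVlt => /orP[/eqP->|lt_u'] lt_v act Euv.
    exact: rows.
  by apply: mono; apply: (cov ok u').
apply: (iteriP (P := fun m st1 => [/\ extends st0 st1,
    forall v, seen st v -> seen st1 v &
    ~~ failed st1 -> ~~ failed st /\ forall v, v < m ->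
      active st0 u -> E u v -> seen st1 v])) => //.
move=> v st1 lt_v [ex1 mono1 cov1]; split.
- by apply: extends_visit => //; apply: old'.
- move=> w /mono1; rewrite /visit; case: ifP => // _.
  case: (st1) => se ac pe bu qu fo bs sa fa sh /= se_w.
  have : set_at se v true w by rewrite /set_at; case: eqP.
  by case: ifP => // _; case: (dec _ _); [case: qu | case: bu].
rewrite /visit; move: cov1; rewrite -(ex_active ex1) => cov1.
case: ifP => [|not_new] .
  case/and3P=> Euv act_u new_v; case: (st1) cov1 => se ac pe bu qu fo bs sa fa sh /= cov1.
  have set_v w : w < v.+1 -> (w < v -> ac u -> E u w -> se w) -> ac u -> E u w ->
      set_at se v true w.
    by rewrite /set_at ltnS leq_eqVlt; case: eqP => //= _ lt_w; apply.
  case: ifP => // _; case: (dec _ _); [case: qu => // qu | case: bu => // bu] => /=.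
    by move=> /cov1[ok cov_v]; split=> // w lt_w; apply: set_v => //; apply: cov_v.
  by move=> /cov1[ok cov_v]; split=> // w lt_w; apply: set_v => //; apply: cov_v.
move=> /cov1[ok cov_v]; split=> // w; rewrite ltnS leq_eqVlt => /orP[/eqP->|].
  by move=> act_u Euv; move: not_new; rewrite Euv act_u /= => /negbFE.
exact: cov_v.
Qed.

Record settled (t : nat) (st : sim) : Prop := Settled {
  st_inv : coherent L D st;
  st_pending : forall v, pending st v = false;
  st_found : ~~ failed st -> forall v, v \in found st ->
    (v \in burnt st) || (v \in saved st);
  st_budget : ~~ failed st -> size (saved st) + budget st = b * t;
  st_closed : ~~ failed st -> forall u v, u \in burnt st -> ~~ active st u ->
    v < n -> E u v -> seen st v;
  st_active : ~~ failed st -> forall u, active st u -> t < size (burnt st) }.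

Lemma settled_layer t st : settled t st ->
  let st' := layer E n b dec L st in
  [/\ settled t.+1 st', ~~ failed st' -> ~~ failed st,
      prefix (saved st) (saved st'), {subset burnt st <= burnt st'} &
      ~~ failed st' -> forall u v, u \in burnt st -> v < n -> E u v -> seen st' v].
Proof.
move=> [I pe0 fo_ok bu_eq closed act_t] st'.
pose st0 := refill b st.
have I0 : coherent L D st0 by apply: inv_refill.
have [[E1 E2 E3 E4] [E5 E6 E7 E8]] :
  [/\ failed st0 = failed st, saved st0 = saved st,
    burnt st0 = burnt st & active st0 = active st] /\
  [/\ found st0 = found st, pending st0 = pending st,
    seen st0 = seen st & budget st0 = budget st + b].
  by rewrite /st0; case: (st).
have ex0 : extends st0 st0.
  split=> //; first exact: prefix_refl.
  - by move=> _ v; rewrite E6 pe0 andbN.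
  - by move=> v; rewrite E6 pe0.
  - by rewrite E1 E5 E3 E2; apply: fo_ok.
have old : {subset burnt st0 <= val s :: found st0} by apply: (inv_burnt I0).
have [ex cov] := extends_scan (leqnn n) old ex0.
pose st1 := scan E n dec L n st0.
have st'E : st' = advance n st1 by [].
have I' : coherent L D st' by apply: inv_advance (ex_inv ex).
have [[F1 F2 F3 F4] [F5 F6 F7 F8]] :
  [/\ failed st' = failed st1, saved st' = saved st1, burnt st' = burnt st1
    & active st' = (fun x => if x < n then pending st1 x else active st1 x)] /\
  [/\ found st' = found st1, pending st' = (fun x => (n <= x) && pending st1 x),
    seen st' = seen st1 & budget st' = budget st1].
  by rewrite st'E; case: (st1).
rewrite -/st1 in ex cov.
have ok01 : ~~ failed st' -> ~~ failed st by rewrite F1 -E1; apply: ex_failed.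
have act' : ~~ failed st' -> forall v, v < n ->
    active st' v = (v \in burnt st') && (v \notin burnt st).
  by move=> ok v lt_v; rewrite F4 lt_v (ex_pending ex) -?F1 // F3 E3.
have small v : v \in burnt st' -> v < n.
  by move/(inv_burnt I'); apply: (inv_lt I').
have cover : ~~ failed st' -> forall u v, u \in burnt st -> v < n -> E u v -> seen st' v.
  move=> ok u v ub lt_v Euv; rewrite F7; case act_u: (active st u).
    apply: (cov _ u) => //; rewrite -?F1 ?E4 //.
    by apply: (inv_lt I); apply: (inv_burnt I).
  apply: (ex_seen ex); rewrite E7; apply: closed Euv => //; last by rewrite act_u.
  exact: ok01.
split=> //.
- split=> //.
  + move=> v; rewrite F6; case: leqP => //= le_v; apply/negP => /(inv_pending (ex_inv ex)).
    by rewrite -F3 => /small; rewrite ltnNge le_v.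
  + by rewrite F1 F5 F3 F2; apply: ex_found ex.
  + by move=> ok; rewrite F2 F8 (ex_budget ex) -?F1 // E2 E8 addnA bu_eq ?ok01 // mulnSr.
  + move=> ok u v ub nact; apply: cover => //.
    by move: nact; rewrite act' ?small // ub /= negbK.
  + move=> ok u act_u.
    have ub : u \in burnt st' by apply: (inv_active I').
    have [w act_w] : exists w, active st w.
      have lt_u := small _ ub; rewrite -E4.
      by apply: (ex_cause ex (v := u)); move: act_u; rewrite F4 lt_u.
    apply: leq_ltn_trans (act_t (ok01 ok) w act_w) _.
    have u_new : u \notin burnt st by move: act_u; rewrite act' ?small // => /andP[].
    apply: (@uniq_leq_size _ (u :: burnt st)); first by rewrite /= u_new (inv_uniq_burnt I).
    move=> x; rewrite inE => /orP[/eqP-> //|xb].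
    by rewrite F3; apply: (ex_burnt ex); rewrite E3.
- by rewrite F2 -E2; apply: ex_saved.
- by rewrite F3 -E3; apply: ex_burnt.
Qed.

Lemma settled_start : settled 0 (start s k).
Proof.
split=> //=; first exact: inv_start_state.
- by rewrite muln0.
- by move=> _ u v; rewrite inE => /eqP->; rewrite /mark eqxx.
Qed.

Lemma settled_state t : settled t (state t).
Proof.
by elim: t => [|t IH]; [apply: settled_start | have [] := settled_layer IH].
Qed.

Section Success.
Hypothesis success : ~~ failed (state n).
Let plan := saved (state n).

Lemma state_ok t : t <= n -> ~~ failed (state t).
Proof.
move=> le_t; have : ~~ failed (state (t + (n - t))) by rewrite subnKC.
elim: (n - t) => [|d IH]; first by rewrite addn0.
rewrite addnS => ok; apply: IH.
by have [_ /(_ ok)] := settled_layer (settled_state (t + d)).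
Qed.

Lemma plan_prefix t : t <= n -> prefix (saved (state t)) plan.
Proof.
move=> le_t; suff from d : prefix (saved (state t)) (saved (state (t + d))).
  by have := from (n - t); rewrite subnKC.
elim: d => [|d IH]; first by rewrite addn0 prefix_refl.
rewrite addnS; apply: prefix_trans IH _.
by have [] := settled_layer (settled_state (t + d)).
Qed.

Lemma burnt_sub t : t <= n -> {subset burnt (state t) <= burnt (state n)}.
Proof.
move=> le_t; suff from d : {subset burnt (state t) <= burnt (state (t + d))}.
  by have := from (n - t); rewrite subnKC.
elim: d => [|d IH]; first by rewrite addn0.
move=> v /IH; rewrite addnS.
by have [_ _ _ sub _] := settled_layer (settled_state (t + d)); apply: sub.
Qed.

Lemma seen_cases t v : t <= n -> seen (state t) v ->
  (v \in burnt (state t)) || (v \in saved (state t)).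
Proof.
move=> le_t; have [I _ fo _ _ _] := settled_state t.
rewrite (inv_seen I) inE => /orP[/eqP->|]; first by rewrite (inv_start I).
by apply: fo; apply: state_ok.
Qed.

Lemma saved_early t v : t <= n -> v \in saved (state t) -> v \in take (b * t) plan.
Proof.
move=> le_t vs; have [I _ _ bu _ _] := settled_state t.
have [r ->] := prefixP (plan_prefix le_t).
have := bu (state_ok le_t) => size_eq.
by rewrite take_cat; case: ltnP => [|_]; [lia | rewrite mem_cat vs].
Qed.

(* The frontier is empty after [n] layers, as every layer with a nonempty
   frontier has burnt a new vertex. *)
Lemma final_closed u v : u \in burnt (state n) -> v < n -> E u v -> seen (state n) v.
Proof.
move=> ub; have [I _ _ _ closed act] := settled_state n.
apply: closed => //; apply/negP => act_u.
have : size (burnt (state n)) <= size (iota 0 n).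
  apply: uniq_leq_size => [|x xb]; first exact: inv_uniq_burnt I.
  by rewrite mem_iota; apply: (inv_lt I); apply: (inv_burnt I).
by rewrite size_iota leqNgt (act success u).
Qed.

Lemma next_cases t u v : u \in burnt (state (minn t n)) -> v < n -> E u v ->
  (v \in burnt (state (minn t.+1 n))) || (v \in take (b * t.+1) plan).
Proof.
move=> ub lt_v Euv; case: (ltnP t n) => le_t.
  rewrite (minn_idPl le_t); rewrite (minn_idPl (ltnW le_t)) in ub.
  have [_ _ _ _ cov] := settled_layer (settled_state t).
  have /(seen_cases le_t)/orP[-> //|vs] := cov (state_ok le_t) u v ub lt_v Euv.
  by rewrite (saved_early le_t vs) orbT.
rewrite (minn_idPr (leqW le_t)); rewrite (minn_idPr le_t) in ub.
have /(seen_cases (leqnn n))/orP[-> //|vs] := final_closed ub lt_v Euv.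
have := saved_early (leqnn n) vs; rewrite -[take (b * n) plan](@take_takel _ _ (b * t.+1)).
  by move/mem_take ->; rewrite orbT.
by rewrite leq_mul2l (leqW le_t) orbT.
Qed.

(** The plan is carried out in order of discovery from the first step on, possibly long before the
    simulation discovers the vertices; by [saved_early] it is never too late. *)
Definition schedule t : {set 'I_n} :=
  [set v | val v \in drop (b * t.-1) (take (b * t) plan)].

(** It suffices that the real fire stays inside the simulated one: this bounds the number of burnt
    vertices, and makes the schedule valid because saved vertices do not burn in the simulation. The
    larger values [b0] and [k0] allow for the cut-off of the numbers in the input. *)
Lemma schedule_correct b0 k0 : b <= b0 -> k <= k0 -> firefighter_yes e s b0 k0.
Proof.
move=> le_b le_k; exists schedule.
have prot t : (ff_state e s schedule t).2 = [set v | val v \in take (b * t) plan].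
  elim: t => [|t IH]; first by apply/setP => v; rewrite /= !inE muln0 take0.
  rewrite protectedS IH; apply/setP => v; rewrite !inE /= -mem_cat.
  rewrite -{1}(@take_takel _ (b * t) (b * t.+1)) ?cat_take_drop //.
  by rewrite leq_mul2l leqnSn orbT.
have burns t v : v \in (ff_state e s schedule t).1 -> val v \in burnt (state (minn t n)).
  elim: t v => [|t IH] v.
    by rewrite min0n !inE => /eqP->.
  rewrite burnedS prot !inE => /orP[/IH vb | /andP[unprot /existsP[u /andP[ub euv]]]].
    case: (ltnP t n) => le_t.
      rewrite (minn_idPl le_t); rewrite (minn_idPl (ltnW le_t)) in vb.
      by have [_ _ _ sub _] := settled_layer (settled_state t); apply: sub.
    by rewrite (minn_idPr (leqW le_t)); rewrite (minn_idPr le_t) in vb.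
  rewrite -EE in euv; have := next_cases (IH u ub) (ltn_ord v) euv.
  by rewrite (negPf unprot) orbF.
have [I _ _ _ _ _] := settled_state n.
have burns_n t v : v \in (ff_state e s schedule t).1 -> val v \in burnt (state n).
  by move/burns; apply: burnt_sub; apply: geq_minr.
split=> [t t_gt0|t]; last first.
  apply: leq_trans le_k; rewrite -(inv_quota I) -size_verts.
  apply: leq_trans (leq_addr _ _); apply: uniq_leq_size; first exact: uniq_verts.
  by move=> x /mapP[v]; rewrite mem_enum => vb ->; apply: burns_n vb.
split.
  apply: (@leq_trans (size (drop (b * t.-1) (take (b * t) plan)))).
    rewrite -size_verts; apply: uniq_leq_size; first exact: uniq_verts.
    by move=> x /mapP[v]; rewrite mem_enum inE => vin ->.
  rewrite size_drop size_take_min; case: t t_gt0 => // t _.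
  by rewrite mulnS /= leq_subLR; apply: leq_trans (geq_minl _ _) _; rewrite addnC leq_add2l.
apply/pred0P => v /=; rewrite inE; apply/negP => /andP[vin vb].
have := inv_disj I (mem_take (mem_drop vin)).
by rewrite (burns_n _ _ vb).
Qed.

End Success.
End Played.
End Correctness.

(** * The search program *)

(* Tracks: 0, 1 input; 2 home; 3 position in the input; 4 length of the input;
   5-8 the numbers n, s, b, k; 9 start of the adjacency matrix; 10-12 arithmetic;
   13, 22, 23, 24, 29 loop indices; 14-16 seen, active, pending; 17 budget;
   18 quota; 19 number of decisions used; 20 failed; 21 short; 25 decisions;
   26 searching; 27 rejecting; 28 number of decisions available. *)
Definition cDiscover : cmd :=
  If 28 19
    (Seq (Put 20 2 true) (Put 21 2 true))
    (Seq (Put 14 24 true)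
    (Seq (If 25 19
            (If 2 18 (Put 20 2 true) (Seq (Dec 18) (Put 16 24 true)))
            (If 2 17 (Put 20 2 true) (Dec 17)))
         (Inc 19))).

(** The position in the matrix advances with every visit, so that the row-major order makes it
    unnecessary to compute [u * n + v]. *)
Definition cVisit : cmd :=
  Seq (If 1 3 (If 15 23 (If 14 24 Skip cDiscover) Skip) Skip) (Inc 3).

Definition cLayer : cmd :=
  Seq (For 13 7 (Inc 17))
  (Seq (Copy 3 9)
  (Seq (For 23 5 (For 24 5 cVisit))
  (Seq (For 13 5 (Seq (If 16 13 (Put 15 13 true) (Put 15 13 false)) (Put 16 13 false)))
       (Zero 3)))).

Definition cSimulate : cmd :=
  Seq (For 13 5 (Seq (Put 14 13 false) (Seq (Put 15 13 false) (Put 16 13 false))))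
  (Seq (Put 14 6 true) (Seq (Put 15 6 true)
  (Seq (Zero 17) (Seq (Copy 18 8) (Seq (Dec 18) (Seq (Zero 19)
  (Seq (Put 20 2 false) (For 22 5 cLayer)))))))).

(** * Correctness and cost of the simulation program *)

Section Program.
Variables (M : nat) (I0 I1 : track) (len n s b k base V W X : nat).

Definition memory (pos i : nat) (se ac pe : track) (bu qu ip : nat) (fa sh : bool)
    (t u v : nat) (sg : track) (go rej : bool) (L j : nat) : seq track :=
  [:: I0; I1; mark 0; mark pos; mark len; mark n; mark s; mark b; mark k; mark base;
      mark V; mark W; mark X; mark i; se; ac; pe; mark bu; mark qu; mark ip;
      flag fa; flag sh; mark t; mark u; mark v; sg; flag go; flag rej; mark L; mark j].

(** Track 21 is not reset by [cSimulate]: it accumulates over all runs of one length, and [r] is the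
    contribution of the earlier ones. *)
Definition mem_of (pos i : nat) (st : sim) (r : bool) (t u v : nat) (sg : track)
    (L : nat) : seq track :=
  memory pos i (seen st) (active st) (pending st) (budget st) (quota st)
    (size (found st)) (failed st) (r || short st) t u v sg true false L 0.

Let E u v := I1 (base + (u * n + v)).

Hypotheses (b_le : n * b + b <= M) (k_le : k <= M) (nn_le : base + n * n <= M)
  (n_le : n <= M) (s_lt : s < n) (k_gt0 : 0 < k).

Section Layers.
Variables (L : nat) (sg : track).
Hypothesis L_le : L <= M.
Let dec (i v : nat) := sg i.

Definition in_range (B : nat) (st : sim) : Prop :=
  [/\ budget st <= B, quota st <= k & size (found st) <= L].

Lemma in_range_visit B u v st : in_range B st -> in_range B (visit E dec L u v st).
Proof.
rewrite /visit; case: ifP => // _; case: st => se ac pe bu qu fo bs sa fa sh [/= h1 h2 h3].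
case: eqP => // ne; have h4 : size (rcons fo v) <= L by rewrite size_rcons; lia.
by case: (dec _ _); [case: qu h2 => [|qu] h2 | case: bu h1 => [|bu] h1]; split=> //=; apply: ltnW.
Qed.

Lemma in_range_row B u m st : in_range B st -> in_range B (scan_row E dec L u m st).
Proof.
move=> h; apply: (iteriP (P := fun _ => in_range B)) => // v y _.
exact: in_range_visit.
Qed.

Lemma in_range_scan B m st : in_range B st -> in_range B (scan E n dec L m st).
Proof.
move=> h; apply: (iteriP (P := fun _ => in_range B)) => // u y _.
exact: in_range_row.
Qed.

Lemma in_range_layer B st :
  in_range B st -> in_range (B + b) (layer E n b dec L st).
Proof.
move=> [h1 h2 h3]; rewrite /layer.
have : in_range (B + b) (refill b st) by case: (st) h1 h2 h3 => /= *; split=> //=; lia.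
by move/(in_range_scan n); case: (scan _ _ _ _ _ _) => *.
Qed.

Lemma in_range_simulate m : in_range (m * b) (simulate E n s b k dec L m).
Proof.
apply: (iteriP (P := fun m => in_range (m * b))) => [|i y _].
  by rewrite mul0n; split=> //=; apply: leq_pred.
by move/in_range_layer; rewrite mulSnr.
Qed.

Section Layer.
Variable r : bool.
Notation memL pos i st t u v := (mem_of pos i st r t u v sg L).

Lemma runs_discover B pos st t u v : B <= M -> in_range B st -> u <= M -> v <= M ->
  runs M cDiscover (memL pos 0 st t u v) (memL pos 0 (discover dec L v st) t u v) 10.
Proof.
case: st => se ac pe bu qu fo bs sa fa sh B_le [/= h1 h2 h3] u_le v_le.
rewrite /cDiscover; apply: (runs_if (v := size fo)) => //; first lia.
rewrite [nth _ _ _]/=; rewrite {1}/mark; case: eqP => [eq_L|ne_L].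
  apply: (runs_weaken (k := (1 + 1))) => //.
  apply: runs_seq; first exact: (runs_flag (u := fa)).
  rewrite /mem_of /= !orbT; exact: (runs_flag (u := r || sh)).
apply: (runs_weaken (k := (1 + (4 + 1)))) => //.
apply: runs_seq; first exact: (runs_put (v := v)).
have ip_le : size fo <= M by lia.
have qu_le : qu <= M by lia.
have bu_le : bu <= M by lia.
case Edec : (sg (size fo)); rewrite /dec Edec.
  case: qu h2 qu_le => [|qu] h2 qu_le.
    apply: (runs_seq (s1 := memory pos 0 (set_at se v true) ac pe bu 0 (size fo) true
       (r || sh) t u v sg true false L 0)).
      apply: (runs_if (v := size fo)) => //=; rewrite Edec.
      apply: (runs_if (v := 0)) => //=.
      by apply: (runs_weaken (k := 1)) => //; apply: (runs_flag (u := fa)).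
    rewrite /mem_of /= size_rcons; exact: (runs_inc (v := size fo)).
  apply: (runs_seq (s1 := memory pos 0 (set_at se v true) ac (set_at pe v true) bu qu
     (size fo) fa (r || sh) t u v sg true false L 0)).
    apply: (runs_if (v := size fo)) => //=; rewrite Edec.
    apply: (runs_if (v := qu.+1)) => //=.
    apply: (runs_seq (k1 := 1) (k2 := 1)).
      by apply: (runs_dec (v := qu)) => //; apply: ltnW.
    exact: (runs_put (v := v)).
  rewrite /mem_of /= size_rcons; exact: (runs_inc (v := size fo)).
case: bu h1 bu_le => [|bu] h1 bu_le.
  apply: (runs_seq (s1 := memory pos 0 (set_at se v true) ac pe 0 qu (size fo) true
     (r || sh) t u v sg true false L 0)).
    apply: (runs_if (v := size fo)) => //=; rewrite Edec.
    apply: (runs_if (v := 0)) => //=.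
    by apply: (runs_weaken (k := 1)) => //; apply: (runs_flag (u := fa)).
  rewrite /mem_of /= size_rcons; exact: (runs_inc (v := size fo)).
apply: (runs_seq (s1 := memory pos 0 (set_at se v true) ac pe bu qu
   (size fo) fa (r || sh) t u v sg true false L 0)).
  apply: (runs_if (v := size fo)) => //=; rewrite Edec.
  apply: (runs_if (v := bu.+1)) => //=.
  apply: (runs_weaken (k := 1)) => //.
  by apply: (runs_dec (v := bu)) => //; apply: ltnW.
rewrite /mem_of /= size_rcons; exact: (runs_inc (v := size fo)).
Qed.

Lemma runs_visit B st t u v : B <= M -> in_range B st -> u < n -> v < n ->
  runs M cVisit (memL (base + (u * n + v)) 0 st t u v)
    (memL (base + (u * n + v)).+1 0 (visit E dec L u v st) t u v) 14.
Proof.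
move=> B_le ok lt_u lt_v.
have pos_le : base + (u * n + v) <= M by nia.
apply: (runs_weaken (k := (13 + 1))) => //.
apply: (runs_seq (s1 := memL (base + (u * n + v)) 0 (visit E dec L u v st) t u v));
  last exact: (runs_inc (v := base + (u * n + v))).
apply: (runs_if (v := base + (u * n + v))) => //; rewrite [nth _ _ _]/=.
rewrite /visit /E; case: (I1 _); last first.
  by apply: (runs_weaken (k := 1)) => //; apply: runs_skip.
apply: (runs_if (v := u)) => //; rewrite ?[nth _ _ _]/=; first lia.
case: (active st u); last first.
  by apply: (runs_weaken (k := 1)) => //; apply: runs_skip.
apply: (runs_if (v := v)) => //; rewrite ?[nth _ _ _]/=; first lia.
case: (seen st v); first by apply: (runs_weaken (k := 1)) => //; apply: runs_skip.
by apply: (runs_discover _ _ B_le) => //; lia.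
Qed.

Lemma runs_row B st t u : B <= M -> in_range B st -> u < n ->
  runs M (For 24 5 cVisit) (memL (base + (u * n + 0)) 0 st t u 0)
    (memL (base + (u.+1 * n + 0)) 0 (scan_row E dec L u n st) t u 0) (n * 16).+2.
Proof.
move=> B_le ok lt_u.
pose st1 x := memL (base + (u * n + x)) 0 (scan_row E dec L u x st) t u x.
pose st2 x := memL (base + (u * n + x)).+1 0 (scan_row E dec L u x.+1 st) t u x.
apply: (runs_for (st := st1) (st' := st2)) => //.
- by move=> x; rewrite /st1 /st2 !addnS.
- by rewrite addn0 mulSnr.
- by move=> x lt_x; apply: (@runs_visit B) => //; apply: in_range_row.
Qed.

Lemma runs_scan B st t : B <= M -> in_range B st ->
  runs M (For 23 5 (For 24 5 cVisit)) (memL (base + (0 * n + 0)) 0 st t 0 0)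
    (memL (base + (n * n + 0)) 0 (scan E n dec L n st) t 0 0)
    (n * (n * 16).+4).+2.
Proof.
move=> B_le ok.
pose st1 x := memL (base + (x * n + 0)) 0 (scan E n dec L x st) t x 0.
pose st2 x := memL (base + (x.+1 * n + 0)) 0 (scan E n dec L x.+1 st) t x 0.
apply: (runs_for (st := st1) (st' := st2)) => // x lt_x.
by apply: (@runs_row B) => //; apply: in_range_scan.
Qed.

Lemma runs_advance pos st t :
  runs M (For 13 5 (Seq (If 16 13 (Put 15 13 true) (Put 15 13 false)) (Put 16 13 false)))
    (memL pos 0 st t 0 0) (memL pos 0 (advance n st) t 0 0) (n * 5).+2.
Proof.
case: st => se ac pe bu qu fo bs sa fa sh.
pose st1 x := memL pos x (advance x (Sim se ac pe bu qu fo bs sa fa sh)) t 0 0.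
pose st2 x := memL pos x (advance x.+1 (Sim se ac pe bu qu fo bs sa fa sh)) t 0 0.
have <- : st1 0 = memL pos 0 (Sim se ac pe bu qu fo bs sa fa sh) t 0 0 by [].
apply: (runs_for (st := st1) (st' := st2)) => // x lt_x.
have le_x : x <= M by lia.
have act_eq : (fun y => if y < x.+1 then pe y else ac y) =
    set_at (fun y => if y < x then pe y else ac y) x (pe x).
  apply: functional_extensionality => y; rewrite /set_at ltnS leq_eqVlt.
  by case: eqP => // ->.
have pend_eq : (fun y => (x.+1 <= y) && pe y) =
    set_at (fun y => (x <= y) && pe y) x false.
  apply: functional_extensionality => y; rewrite /set_at ltn_neqAle eq_sym.
  by case: eqP.
rewrite /st1 /st2 /mem_of /= act_eq pend_eq.
apply: (runs_weaken (k := 2 + 1)) => //.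
apply: (runs_seq (s1 := memory pos x se (set_at (fun y => if y < x then pe y else ac y) x (pe x))
   (fun y => (x <= y) && pe y) bu qu (size fo) fa (r || sh) t 0 0 sg true false L 0)).
  apply: (runs_if (v := x)) => //; rewrite [nth _ _ _]/= [X in if X then _ else _]/= leqnn.
  by case: (pe x); apply: (runs_put (v := x)).
exact: (runs_put (v := x)).
Qed.

Lemma runs_layer B st t : B + b <= M -> in_range B st ->
  runs M cLayer (memL 0 0 st t 0 0) (memL 0 0 (layer E n b dec L st) t 0 0)
    (b * 3 + n * (n * 16).+4 + n * 5 + 8).
Proof.
move=> B_le ok; have b_le' : b <= M by lia.
have ok' : in_range (B + b) (refill b st).
  by case: (st) ok => se ac pe bu qu fo bs sa fa sh [/= *]; split=> //=; lia.
apply: (runs_weaken (k := (b * 3).+2 + (1 + ((n * (n * 16).+4).+2 + ((n * 5).+2 + 1))))).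
  lia.
apply: (runs_seq (s1 := memL 0 0 (refill b st) t 0 0)).
  case: st ok ok' => se ac pe bu qu fo bs sa fa sh [/= h1 h2 h3] _.
  pose st1 x := memL 0 x (Sim se ac pe (bu + x) qu fo bs sa fa sh) t 0 0.
  pose st2 x := memL 0 x (Sim se ac pe (bu + x).+1 qu fo bs sa fa sh) t 0 0.
  have <- : st1 0 = memL 0 0 (Sim se ac pe bu qu fo bs sa fa sh) t 0 0.
    by rewrite /st1 addn0.
  apply: (runs_for (st := st1) (st' := st2)) => //.
    by move=> x; rewrite /st1 addnS.
  by move=> x lt_x; apply: (runs_inc (v := bu + x)) => //; lia.
apply: (runs_seq (s1 := memL (base + (0 * n + 0)) 0 (refill b st) t 0 0)).
  rewrite mul0n !addn0; apply: (runs_copy (u := 0) (v := base)) => //; lia.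
apply: runs_seq; first exact: (@runs_scan (B + b)).
apply: runs_seq; first exact: runs_advance.
by apply: (runs_zero (v := base + (n * n + 0))) => //; rewrite addn0.
Qed.

End Layer.

Definition layer_cost := b * 3 + n * (n * 16).+4 + n * 5 + 8.

(** Each run clears only the cells below [n], so nothing may be left beyond them by the run
    before. *)
Definition empty_from (f : track) : Prop := forall x, n <= x -> ~~ f x.

Lemma runs_simulate se ac pe bu qu ip fa sh : bu <= M -> qu <= M -> ip <= M ->
  empty_from se -> empty_from ac -> empty_from pe ->
  runs M cSimulate (memory 0 0 se ac pe bu qu ip fa sh 0 0 0 sg true false L 0)
    (mem_of 0 0 (simulate E n s b k dec L n) sh 0 0 0 sg L)
    (n * 5 + n * layer_cost.+2 + 12).
Proof.
move=> bu_le qu_le ip_le se_sup ac_sup pe_sup; have s_le : s <= M by lia.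
have clear f : empty_from f -> (fun y => (n <= y) && f y) = none.
  move=> sup; apply: functional_extensionality => y.
  by case: leqP => //= le_y; apply/negbTE/sup.
have clearS f x : (fun y => (x < y) && f y) = set_at (fun y => (x <= y) && f y) x false.
  apply: functional_extensionality => y; rewrite /set_at ltn_neqAle eq_sym.
  by case: eqP.
have mark_eq x : set_at none x true = mark x.
  by apply: functional_extensionality => y; rewrite /set_at /mark; case: eqP.
apply: (runs_weaken (k := (n * 5).+2 +
  (1 + (1 + (1 + (1 + (1 + (1 + (1 + (n * layer_cost.+2).+2))))))))); first lia.
apply: (runs_seq (s1 := memory 0 0 none none none bu qu ip fa sh 0 0 0 sg
   true false L 0)).
  pose st1 x := memory 0 x (fun y => (x <= y) && se y) (fun y => (x <= y) && ac y)
    (fun y => (x <= y) && pe y) bu qu ip fa sh 0 0 0 sg true false L 0.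
  pose st2 x := memory 0 x (fun y => (x < y) && se y) (fun y => (x < y) && ac y)
    (fun y => (x < y) && pe y) bu qu ip fa sh 0 0 0 sg true false L 0.
  rewrite -/(st1 0).
  apply: (runs_for (st := st1) (st' := st2)) => //.
    by rewrite /st1 /= !clear.
  move=> x lt_x; have le_x : x <= M by lia.
  rewrite /st2 !clearS.
  apply: (runs_seq (k1 := 1) (k2 := 2)); first exact: (runs_put (v := x)).
  apply: (runs_seq (k1 := 1) (k2 := 1)); first exact: (runs_put (v := x)).
  exact: (runs_put (v := x)).
apply: (runs_seq (s1 := memory 0 0 (set_at none s true) none none bu qu ip fa sh
   0 0 0 sg true false L 0)); first exact: (runs_put (v := s)).
apply: (runs_seq (s1 := memory 0 0 (set_at none s true) (set_at none s true) none bu qu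
   ip fa sh 0 0 0 sg true false L 0)); first exact: (runs_put (v := s)).
rewrite mark_eq.
apply: runs_seq; first by apply: (runs_zero (v := bu)).
apply: runs_seq; first by apply: (runs_copy (u := qu) (v := k)) => //; lia.
apply: runs_seq.
  by apply: (runs_dec (v := k.-1)) => //; [rewrite /= prednK | lia].
apply: runs_seq; first by apply: (runs_zero (v := ip)) => //; lia.
apply: runs_seq; first exact: (runs_flag (u := fa)).
pose st1 x := mem_of 0 0 (simulate E n s b k dec L x) sh x 0 0 sg L.
pose st2 x := mem_of 0 0 (simulate E n s b k dec L x.+1) sh x 0 0 sg L.
suff : runs M (For 22 5 cLayer) (st1 0)
    (mem_of 0 0 (simulate E n s b k dec L n) sh 0 0 0 sg L) (n * layer_cost.+2).+2.
  by rewrite /st1 /mem_of /= orbF.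
apply: (runs_for (st := st1) (st' := st2)) => // x lt_x.
have le_x : x * b <= n * b by rewrite leq_mul2r ltnW ?orbT.
by apply: (@runs_layer sh (x * b)); [lia | apply: in_range_simulate].
Qed.
End Layers.

(* Moves on to the next sequence of decisions, seen as a number in binary. *)
Definition cNext : cmd :=
  Seq (Loop 25 25 true 29 (Seq (Put 25 29 false) (Inc 29)))
  (Seq (If 28 29
          (If 21 2 (Seq (Put 21 2 false) (Inc 28)) (Seq (Put 27 2 true) (Put 26 2 false)))
          (Put 25 29 true))
       (Zero 29)).

Definition cSearch : cmd :=
  Loop 26 26 true 2 (Seq cSimulate (If 20 2 cNext (Put 26 2 false))).

Lemma runs_carry se ac pe bu qu ip fa sh L m j : j <= M ->
  (forall i, i < j -> testbit m i) -> ~~ testbit m j ->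
  runs M (Loop 25 25 true 29 (Seq (Put 25 29 false) (Inc 29)))
    (memory 0 0 se ac pe bu qu ip fa sh 0 0 0 (testbit m) true false L 0)
    (memory 0 0 se ac pe bu qu ip fa sh 0 0 0 (fun x => (j <= x) && testbit m x)
       true false L j) (j * 3).+1.
Proof.
move=> j_le ones zero.
pose st x := memory 0 0 se ac pe bu qu ip fa sh 0 0 0 (fun y => (x <= y) && testbit m y)
  true false L x.
rewrite -/(st 0) -/(st j).
apply: (runs_loop (st := st) (v := id)) => [x le_x|x lt_x||x lt_x].
- by split=> //; apply: leq_trans j_le.
- by rewrite [nth _ _ _]/= /= leqnn orbb ones.
- by rewrite [nth _ _ _]/= /= leqnn orbb (negPf zero).
apply: (runs_seq (k1 := 1) (k2 := 1)).
  by apply: (runs_put (v := x)) => //; lia.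
have -> : st x.+1 = memory 0 0 se ac pe bu qu ip fa sh 0 0 0
    (set_at (fun y => (x <= y) && testbit m y) x false) true false L x.+1.
  congr memory; apply: functional_extensionality => y; rewrite /set_at ltn_neqAle eq_sym.
  by case: eqP.
by apply: (runs_inc (v := x)) => //; lia.
Qed.

(** * The search through all decision sequences *)

Section Search.
Variables (Lmax : nat) (yes : Prop).
Let run L m := simulate E n s b k (fun i _ => testbit m i) L n.
Hypotheses (success : forall L m, ~~ failed (run L m) -> yes)
  (refuted : forall L, (forall m, m < 2 ^ L -> failed (run L m) /\ ~~ short (run L m)) ->
     ~ yes)
  (bounded : (exists2 m, m < 2 ^ Lmax & ~~ failed (run Lmax m)) \/
     forall m, ~~ short (run Lmax m))
  (support : forall L m, [/\ empty_from (seen (run L m)), empty_from (active (run L m))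
     & empty_from (pending (run L m))])
  (Lmax_le : Lmax <= M).

Definition round_cost := n * 5 + n * layer_cost.+2 + Lmax * 3 + 20.

(** The sequence [m] of length [L] has number [2 ^ L + m] in the order of the search, which is [m]
    in binary with a leading 1. All numbers up to length [Lmax] are below [2 ^ Lmax.+1], so [R]
    counts the rounds that may remain. *)
Lemma runs_search R L m se ac pe bu qu ip fa sh : bu <= M -> qu <= M -> ip <= M ->
  empty_from se -> empty_from ac -> empty_from pe ->
  L <= Lmax -> m < 2 ^ L -> R = 2 ^ Lmax.+1 - (2 ^ L + m) ->
  (forall m', m' < m -> failed (run L m')) ->
  (~~ sh -> forall m', m' < m -> ~~ short (run L m')) ->
  (sh -> exists m', short (run L m')) ->
  exists2 s', runs M cSearch
      (memory 0 0 se ac pe bu qu ip fa sh 0 0 0 (testbit m) true false L 0) s'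
      (R * round_cost.+1).+1
    & nth none s' 27 0 = false <-> yes.
Proof.
elim: R L m se ac pe bu qu ip fa sh =>
  [|R IH] L m se ac pe bu qu ip fa sh bu_le qu_le ip_le se_e ac_e pe_e
  L_le m_lt R_eq fails shorts was_short.
  have : 2 ^ L <= 2 ^ Lmax by rewrite leq_exp2l.
  by rewrite expnS in R_eq; lia.
have L_leM : L <= M by apply: leq_trans Lmax_le.
set s0 := memory 0 0 se ac pe bu qu ip fa sh 0 0 0 (testbit m) true false L 0.
have sim := runs_simulate (testbit m) L_leM fa sh bu_le qu_le ip_le se_e ac_e pe_e.
have [bu1 qu1 ip1] := in_range_simulate (testbit m) L_leM n.
have [se1 ac1 pe1] := support L m.
rewrite -/(run L m) in sim bu1 qu1 ip1.
set st := run L m in sim bu1 qu1 ip1 se1 ac1 pe1.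
have bu1_le : budget st <= M by lia.
have qu1_le : quota st <= M by lia.
have ip1_le : size (found st) <= M by lia.
have step s1 s2 k1 : k1 <= Lmax * 3 + 8 ->
    runs M (If 20 2 cNext (Put 26 2 false)) (mem_of 0 0 st sh 0 0 0 (testbit m) L) s1 k1 ->
    runs M cSearch s1 s2 (R * round_cost.+1).+1 ->
    runs M cSearch s0 s2 (R.+1 * round_cost.+1).+1.
  move=> k1_le run1 run2.
  apply: runs_weaken (runs_loop_step (v := 0) _ _ _ _ (runs_seq sim run1) run2) => //.
  by rewrite /round_cost; lia.
case fa_st: (failed st); last first.
  exists (memory 0 0 (seen st) (active st) (pending st) (budget st) (quota st)
    (size (found st)) false (sh || short st) 0 0 0 (testbit m) false false L 0); last first.
    by split=> // _; apply: (success (L := L) (m := m)); rewrite -/st fa_st.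
  apply: (step _ _ 2).
  - by rewrite addnC.
  - apply: (runs_if (v := 0)) => //; rewrite [nth _ _ _]/= fa_st.
    by rewrite /mem_of fa_st; apply: (runs_flag (u := true)).
  - by apply: runs_weaken (runs_loop_stop (v := 0) _ _ _ _).
have fails' m' : m' < m.+1 -> failed (run L m').
  by rewrite ltnS leq_eqVlt => /orP[/eqP-> //|/fails].
have shorts' : ~~ (sh || short st) -> forall m', m' < m.+1 -> ~~ short (run L m').
  rewrite negb_or => /andP[nsh nst] m'; rewrite ltnS leq_eqVlt.
  by move=> /orP[/eqP-> //|]; apply: shorts.
have was_short' : sh || short st -> exists m', short (run L m').
  by case/orP=> [/was_short //|]; exists m.
(* The lowest zero [j] of [m] is where the carry stops; it equals [L] iff [m] is the last sequence
   of its length. *)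
have exz : exists i, ~~ testbit m i by exists L; rewrite (testbit_ge m_lt).
case: (ex_minnP exz) => j zero minj.
have ones i : i < j -> testbit m i.
  by move=> lt_i; apply: contraT => /minj; rewrite leqNgt lt_i.
have le_j : j <= L by apply: minj; rewrite (testbit_ge m_lt).
have j_le : j <= M by lia.
have carry := runs_carry (seen st) (active st) (pending st) (budget st) (quota st)
  (size (found st)) true (sh || short st) L j_le ones zero.
have next s1 k1 s2 : k1 <= 5 -> runs M (If 28 29
          (If 21 2 (Seq (Put 21 2 false) (Inc 28)) (Seq (Put 27 2 true) (Put 26 2 false)))
          (Put 25 29 true)) (memory 0 0 (seen st) (active st) (pending st) (budget st) (quota st)
    (size (found st)) true (sh || short st) 0 0 0 (fun x => (j <= x) && testbit m x)
       true false L j) s1 k1 ->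
    runs M (Zero 29) s1 s2 1 ->
    runs M (If 20 2 cNext (Put 26 2 false)) (mem_of 0 0 st sh 0 0 0 (testbit m) L) s2
      (Lmax * 3 + 8).
  move=> k1_le run1 run2; rewrite /mem_of fa_st.
  apply: (runs_weaken (k := ((j * 3).+1 + (k1 + 1)).+1)); first lia.
  apply: (runs_if (v := 0)) => //; rewrite [nth _ _ _]/=.
  exact: runs_seq carry (runs_seq run1 run2).
case: (ltnP j L) => [lt_j|ge_j].
  have m1_lt : m.+1 < 2 ^ L.
    rewrite ltn_neqAle m_lt andbT; apply/negP => /eqP m1.
    have := testbit_succ ones zero; rewrite m1 => /(congr1 (fun f => f j)).
    have -> : testbit (2 ^ L) j = false.
      rewrite -(bits_val_pred1 (ltnSn L)) testbit_bits_val.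
      by apply/negP => /andP[_ /eqP]; lia.
    by rewrite eqxx.
  have [|s2 run2 ans] := IH L m.+1 (seen st) (active st) (pending st) (budget st) (quota st)
    (size (found st)) true (sh || short st) bu1_le qu1_le ip1_le se1 ac1 pe1 L_le m1_lt
    _ fails' shorts' was_short'; first lia.
  exists s2 => //; apply: step run2; first exact: leqnn.
  apply: (next _ 2); [by [] | | ].
    apply: (runs_if (v := j)) => //; rewrite [nth _ _ _]/= {1}/mark ltn_eqF //.
    exact: (runs_put (v := j)).
  have -> : testbit m.+1 = set_at (fun x => (j <= x) && testbit m x) j true.
    rewrite (testbit_succ ones zero); apply: functional_extensionality => x.
    by rewrite /set_at ltn_neqAle eq_sym; case: eqP.
  by apply: (runs_zero (v := j)).
have eq_j : j = L by lia.
have full : m.+1 = 2 ^ L.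
  by apply: testbit_all_ones => // i; rewrite -eq_j; apply: ones.
have zeros : (fun x => (j <= x) && testbit m x) = testbit 0.
  apply: functional_extensionality => x; rewrite testbit_zero eq_j.
  by case: leqP => //= le_x; rewrite (testbit_ge m_lt).
rewrite full in fails' shorts'.
(* All sequences of length [L] have failed. If none was short of bits the instance is refuted;
   otherwise the search continues with [L.+1] zeros, and [bounded] excludes this case for
   [L = Lmax]. *)
case sh_st: (sh || short st); last first.
  rewrite sh_st in next shorts'.
  set s2 := memory 0 0 (seen st) (active st) (pending st) (budget st) (quota st)
    (size (found st)) true false 0 0 0 (testbit 0) false true L 0.
  exists s2; last first.
    split=> // y; case: (refuted (L := L)) => // m' lt_m'.
    by split; [apply: fails' | apply: shorts'].
  apply: (step s2); first exact: leqnn.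
    apply: (next _ 4); [by [] | | ]; last first.
      rewrite /s2 -zeros.
      apply: (runs_zero (v := j) (s := memory 0 0 (seen st) (active st) (pending st)
        (budget st) (quota st) (size (found st)) true false 0 0 0
        (fun x => (j <= x) && testbit m x) false true L j)) => //.
    apply: (runs_if (v := j)) => //; rewrite [nth _ _ _]/= {1}/mark eq_j eqxx.
    apply: (runs_if (v := 0)) => //; rewrite [nth _ _ _]/=.
    apply: (runs_seq (k1 := 1) (k2 := 1)); first exact: (runs_flag (u := false)).
    exact: (runs_flag (u := true)).
  by apply: runs_weaken (runs_loop_stop (v := 0) _ _ _ _).
have lt_L : L < Lmax.
  rewrite ltn_neqAle L_le andbT; apply/negP => /eqP eq_L.
  case: bounded => [[m' lt_m' ok] | never].
    by move: ok; rewrite -eq_L fails' // eq_L.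
  by have [m'] := was_short' sh_st; rewrite eq_L (negPf (never m')).
rewrite sh_st in next.
have [|||||s2 run2 ans] := IH L.+1 0 (seen st) (active st) (pending st) (budget st) (quota st)
  (size (found st)) true false bu1_le qu1_le ip1_le se1 ac1 pe1 lt_L.
- by rewrite expn_gt0.
- by rewrite addn0 (expnS 2 L); lia.
- by [].
- by [].
- by [].
exists s2 => //; apply: step run2; first exact: leqnn.
apply: (next _ 4); [by [] | | ]; last first.
  rewrite -zeros; apply: (runs_zero (v := j) (s := memory 0 0 (seen st) (active st) (pending st)
    (budget st) (quota st) (size (found st)) true false 0 0 0
    (fun x => (j <= x) && testbit m x) true false L.+1 j)) => //.
apply: (runs_if (v := j)) => //; rewrite [nth _ _ _]/= {1}/mark eq_j eqxx.
apply: (runs_if (v := 0)) => //; rewrite [nth _ _ _]/=.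
apply: (runs_seq (k1 := 1) (k2 := 1)); first exact: (runs_flag (u := true)).
exact: (runs_inc (v := L)).
Qed.
End Search.
End Program.

(** * Reading the instance *)

Definition bits_nat (l : seq bool) : nat := foldr (fun (x : bool) v => x + v.*2) 0 l.

Lemma bits_nat_binary m : bits_nat (binary m) = m.
Proof.
suff aux f : forall m, m <= f -> bits_nat (bits_aux f m) = m by apply: aux.
elim: f => [|f IH] {}m; first by case: m.
by move=> le_m /=; case: eqP => [-> //|ne] /=; rewrite IH; lia.
Qed.

Lemma bits_nat_take l x : x < size l ->
  bits_nat (take x.+1 l) = bits_nat (take x l) + nth false l x * 2 ^ x.
Proof.
elim: l x => // c l IH [|x]; first by case: c; rewrite /= take0.
by rewrite /= ltnS => lt_x; have /= -> := IH x lt_x; rewrite expnS; case: nth; lia.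
Qed.

Lemma size_flatten_pairs (l : seq bool) :
  size (flatten [seq [:: true; x] | x <- l]) = (size l).*2.
Proof. by elim: l => //= c l ->. Qed.

Lemma nth_encnat m post (l := binary m) :
  [/\ forall x, x < size l -> nth false (encnat m ++ post) (2 * x),
      forall x, x < size l -> nth false (encnat m ++ post) (2 * x).+1 = nth false l x,
      nth false (encnat m ++ post) (2 * size l) = false &
      size (encnat m) = 2 * size l + 2].
Proof.
rewrite /encnat -/l -catA size_cat size_flatten_pairs /= -mul2n.
have body x : x < size l -> nth false (flatten [seq [:: true; x] | x <- l] ++
    [:: false; false] ++ post) (2 * x) = true /\
   nth false (flatten [seq [:: true; x] | x <- l] ++ [:: false; false] ++ post)
      (2 * x).+1 = nth false l x.
  by elim: (l) x => // c l' IH [|x] // lt_x; rewrite mulnS; apply: IH.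
split=> // [x /body[-> _] | x /body[_ ->] |] //.
by rewrite nth_cat size_flatten_pairs -mul2n ltnn subnn.
Qed.

(** As long as track 2 is unmarked there is no way home, so the registers are set up by bare writes
    with the head still at position 0. *)
Definition cInit (rs : seq nat) : cmd :=
  foldr (fun j c => Seq (Write j true) c) (Write 2 true) rs.

Lemma exec_init s rs : nth none s 2 = none -> {in rs, forall j, nth none s j = none} ->
  uniq (2 :: rs) ->
  exec (cInit rs) s 0 (size rs).+1
    (set_nth none (foldl (fun s j => set_nth none s j (mark 0)) s rs) 2 (mark 0)) 0.
Proof.
elim: rs s => [|j rs IH] s s_2 s_rs uniq_rs.
  by rewrite /= -write_none //; apply: ExecWrite.
have s_j : nth none s j = none by apply: s_rs; apply: mem_head.
move: uniq_rs; rewrite /= inE negb_or => /andP[/andP[ne2 rs2] /andP[rsj uniq_rs]].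
have ex1 := ExecWrite j true s 0; rewrite write_none // in ex1.
apply: (ExecSeq ex1); apply: IH.
- by rewrite nth_set_other.
- move=> i i_rs; rewrite nth_set_other ?s_rs ?inE ?i_rs ?orbT //.
  by apply: contraNneq rsj => <-.
- by rewrite /= rs2.
Qed.

Definition cLength : cmd :=
  Seq (Inc 3) (Seq (Loop 0 1 true 3 (Inc 3)) (Seq (Copy 4 3) (Seq (Zero 3) (Inc 3)))).

(* Sums are capped at the length of the input, since the values of b and k may
   be exponential in it; as it exceeds n, this does not change the answer. *)
Definition cAdd x y : cmd := For 13 y (If x 4 Skip (Inc x)).

(** Register 10 sums up the value, least significant bit first, and 11 is the current power of two.
    It is doubled through the copy in 12, because the bound of the loop in [cAdd] must not change
    while it runs. *)
Definition cParse : cmd :=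
  Seq (Zero 10) (Seq (Zero 11) (Seq (Inc 11)
  (Seq (Loop 1 1 true 3
          (Seq (Inc 3) (Seq (If 1 3 (cAdd 10 11) Skip)
             (Seq (Copy 12 11) (Seq (cAdd 11 12) (Inc 3))))))
       (Seq (Inc 3) (Inc 3))))).

Definition cMain : cmd :=
  Seq (cInit [:: 3; 4; 5; 6; 7; 8; 9; 10; 11; 12; 13; 17; 18; 19; 22; 23; 24; 28; 29])
  (Seq cLength
  (Seq cParse (Seq (Copy 5 10)
  (Seq cParse (Seq (Copy 6 10)
  (Seq cParse (Seq (Copy 7 10)
  (Seq cParse (Seq (Copy 8 10)
  (Seq (Copy 9 3) (Seq (Zero 3) (Seq (Put 26 2 true) cSearch)))))))))))).

Section Reading.
Variables (M : nat) (w : seq bool).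
Let I0 : track := fun x => (0 < x <= size w) && ~~ nth false w x.-1.
Let I1 : track := fun x => (0 < x) && nth false w x.-1.
Let len := (size w).+1.
Hypothesis len_le : len < M.

Notation reading len n s b k base V W X pos i :=
  (memory I0 I1 len n s b k base V W X pos i none none none 0 0 0 false false
     0 0 0 none false false 0 0).

Lemma runs_length :
  runs M cLength (reading 0 0 0 0 0 0 0 0 0 0 0) (reading len 0 0 0 0 0 0 0 0 1 0)
    (len * 2 + 5).
Proof.
apply: (runs_weaken (k := 1 + ((size w * 2).+1 + (1 + (1 + 1))))).
  by rewrite /len; lia.
apply: (runs_seq (s1 := reading 0 0 0 0 0 0 0 0 0 1 0)); first exact: (runs_inc (v := 0)).
apply: (runs_seq (s1 := reading 0 0 0 0 0 0 0 0 0 len 0)).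
  apply: (runs_loop (st := fun x => reading 0 0 0 0 0 0 0 0 0 x.+1 0) (v := succn)).
  - by move=> x le_x; split=> //; have := len_le; rewrite /len; lia.
  - by move=> x lt_x; rewrite [nth _ _ 0]/= [nth _ _ 1]/= /I0 /I1 /= lt_x orNb.
  - by rewrite [nth _ _ 0]/= [nth _ _ 1]/= /I0 /I1 /= ltnn nth_default.
  - by move=> x lt_x; apply: (runs_inc (v := x.+1)) => //; have := len_le; rewrite /len; lia.
apply: runs_seq; first by apply: (runs_copy (u := 0) (v := len)) => //; lia.
apply: runs_seq; first by apply: (runs_zero (v := len)) => //; lia.
exact: (runs_inc (v := 0)).
Qed.

Section Parse.
Variables (n s b k base : nat).
Notation parsing V W X pos i := (reading len n s b k base V W X pos i).

Lemma runs_add_value V W X pos : V <= len -> W <= len ->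
  runs M (cAdd 10 11) (parsing V W X pos 0) (parsing (minn len (V + W)) W X pos 0)
    (len * 4 + 2).
Proof.
move=> V_le W_le; apply: (runs_weaken (k := (W * 4).+2)); first lia.
pose st x := parsing (minn len (V + x)) W X pos x.
pose st' x := parsing (minn len (V + x.+1)) W X pos x.
have {1}-> : V = minn len (V + 0) by lia.
apply: (runs_for (st := st) (st' := st')) => //; first lia.
move=> x lt_x; apply: (runs_if (v := len)) => //; first lia.
rewrite [nth _ _ _]/= {1}/mark; case: eqP => [eq_len|ne_len].
  have -> : st' x = st x by rewrite /st /st'; congr memory; lia.
  exact: runs_skip.
have -> : st' x = parsing (minn len (V + x)).+1 W X pos x by rewrite /st'; congr memory; lia.
by apply: (runs_inc (v := minn len (V + x))) => //; lia.
Qed.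

Lemma runs_add_weight V W pos : W <= len ->
  runs M (cAdd 11 12) (parsing V W W pos 0) (parsing V (minn len (W + W)) W pos 0)
    (len * 4 + 2).
Proof.
move=> W_le; apply: (runs_weaken (k := (W * 4).+2)); first lia.
pose st x := parsing V (minn len (W + x)) W pos x.
pose st' x := parsing V (minn len (W + x.+1)) W pos x.
have -> : parsing V W W pos 0 = st 0 by rewrite /st; congr memory; lia.
apply: (runs_for (st := st) (st' := st')) => //; first lia.
move=> x lt_x; apply: (runs_if (v := len)) => //; first lia.
rewrite [nth _ _ _]/= {1}/mark; case: eqP => [eq_len|ne_len].
  have -> : st' x = st x by rewrite /st /st'; congr memory; lia.
  exact: runs_skip.
have -> : st' x = parsing V (minn len (W + x)).+1 W pos x by rewrite /st'; congr memory; lia.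
by apply: (runs_inc (v := minn len (W + x))) => //; lia.
Qed.

Definition parse_cost := len * (len * 8 + 12) + 8.

Lemma runs_parse V W X m pre post : w = pre ++ encnat m ++ post ->
  V <= len -> W <= len -> X <= len ->
  exists W' X', [/\ W' <= len, X' <= len &
    runs M cParse (parsing V W X (size pre).+1 0)
      (parsing (minn len m) W' X' (size pre + size (encnat m)).+1 0) parse_cost].
Proof.
move=> w_eq V_le W_le X_le; set p := (size pre).+1.
have [mark_bit value_bit stop_bit size_m] := nth_encnat m post.
set l := binary m in mark_bit value_bit stop_bit size_m.
have I1E y : I1 (p + y) = nth false (encnat m ++ post) y.
  by rewrite /I1 /p addSn /= w_eq nth_cat ltnNge leq_addr /= addKn.
have size_w : size pre + (2 * size l + 2) + size post = size w.
  by rewrite w_eq size_cat size_cat size_m; lia.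
pose Vx x := minn len (bits_nat (take x l)).
pose Wx x := minn len (2 ^ x).
pose Xx x := if x is x'.+1 then Wx x' else X.
pose st x := parsing (Vx x) (Wx x) (Xx x) (p + 2 * x) 0.
have Xx_le x : Xx x <= len by case: x => //= x; rewrite geq_minl.
exists (Wx (size l)), (Xx (size l)); split; rewrite ?geq_minl //.
apply: (runs_weaken (k := 1 + (1 + (1 + ((size l * (len * 8 + 8).+1).+1 + (1 + 1)))))).
  have le_l : size l <= len by rewrite /len; lia.
  by have := leq_mul le_l (leqnn (len * 8 + 9)); rewrite /parse_cost; lia.
apply: runs_seq; first by apply: (runs_zero (v := V)) => //; lia.
apply: runs_seq; first by apply: (runs_zero (v := W)) => //; lia.
apply: (runs_seq (s1 := parsing 0 1 X p 0)); first exact: (runs_inc (v := 0)).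
apply: (runs_seq (s1 := st (size l))).
  have -> : parsing 0 1 X p 0 = st 0.
    by rewrite /st /Vx /Wx take0 /= muln0 addn0 minn0; congr memory; rewrite /len; lia.
  apply: (runs_loop (st := st) (v := fun x => p + 2 * x)).
  - by move=> x le_x; split=> //; have := len_le; rewrite /p /len; lia.
  - by move=> x lt_x; rewrite [nth _ _ _]/= orbb I1E mark_bit.
  - by rewrite [nth _ _ _]/= orbb I1E stop_bit.
  move=> x lt_x.
  have pos_le : p + 2 * x < M by have := len_le; rewrite /p /len; lia.
  apply: (runs_weaken (k := 1 + ((len * 4 + 2).+1 + (1 + ((len * 4 + 2) + 1))))); first lia.
  apply: runs_seq; first by apply: (runs_inc (v := p + 2 * x)) => //; lia.
  apply: (runs_seq (s1 := parsing (Vx x.+1) (Wx x) (Xx x) (p + 2 * x).+1 0)).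
    apply: (runs_if (v := (p + 2 * x).+1)) => //.
    rewrite [nth _ _ _]/= -addnS I1E value_bit // /Vx bits_nat_take //.
    case: nth; rewrite ?mul0n ?mul1n ?addn0.
      (* Capping the summands does not change the capped sum, so all intermediate values may be
         capped. *)
      have -> : minn len (bits_nat (take x l) + 2 ^ x) =
        minn len (minn len (bits_nat (take x l)) + minn len (2 ^ x)) by lia.
      by apply: runs_add_value; rewrite geq_minl.
    by apply: (runs_weaken (k := 1)); [lia | apply: runs_skip].
  apply: (runs_seq (s1 := parsing (Vx x.+1) (Wx x) (Wx x) (p + 2 * x).+1 0)).
    by apply: (runs_copy (u := Xx x) (v := Wx x)) => //;
      [have := Xx_le x | have := geq_minl len (2 ^ x)]; rewrite -/(Wx x); lia.
  have -> : st x.+1 = parsing (Vx x.+1) (minn len (Wx x + Wx x)) (Wx x) (p + 2 * x).+2 0.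
    by rewrite /st /Wx expnS; congr memory; lia.
  apply: runs_seq; first by apply: runs_add_weight; rewrite geq_minl.
  exact: (runs_inc (v := (p + 2 * x).+1)).
have -> : minn len m = Vx (size l) by rewrite /Vx take_size bits_nat_binary.
have -> : (size pre + size (encnat m)).+1 = (p + 2 * size l).+2 by rewrite size_m /p; lia.
apply: (runs_seq (k1 := 1) (k2 := 1)).
  by apply: (runs_inc (v := p + 2 * size l)) => //; have := len_le; rewrite /p /len; lia.
by apply: (runs_inc (v := (p + 2 * size l).+1)) => //; have := len_le; rewrite /p /len; lia.
Qed.

End Parse.
End Reading.

Lemma nth_allpairs (A B C : Type) (f : A -> B -> C) (x : A) (y : B) (z : C)
    (us : seq A) (vs : seq B) u v : u < size us -> v < size vs ->
  nth z [seq f a c | a <- us, c <- vs] (u * size vs + v) = f (nth x us u) (nth y vs v).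
Proof.
move=> + lt_v; elim: us u => // a us IH [|u] lt_u /=.
  by rewrite mul0n add0n nth_cat size_map lt_v (nth_map y).
rewrite nth_cat size_map ifN; last by rewrite mulSn -leqNgt -addnA leq_addr.
by rewrite mulSn -addnA addKn IH.
Qed.

Lemma contains_mono n (e : rel 'I_n) s b b' k k' X : b <= b' -> k <= k' ->
  contains e s b k X -> contains e s b' k' X.
Proof.
move=> le_b le_k [sX ball_k sched]; split=> // t; first exact: leq_trans (ball_k t) le_k.
by apply: leq_trans (sched t) _; rewrite leq_mul2r le_b orbT.
Qed.

(** * The whole program on an encoded instance *)

Section Instance.
Variables (n : nat) (e : rel 'I_n) (s : 'I_n) (b0 k0 p : nat).
Hypotheses (b0_gt0 : 0 < b0) (k0_gt0 : 0 < k0) (pw : pathwidth_le e p).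
Let w := enc_instance e s b0 k0.
Let I0 : track := fun x => (0 < x <= size w) && ~~ nth false w x.-1.
Let I1 : track := fun x => (0 < x) && nth false w x.-1.
Let len := (size w).+1.
Let D := max_degree e.
Let g := D.+1 ^ radius e p.+1 p.+1.
Let Lmax := g * D.
Let b := minn len b0.
Let k := minn len k0.
Let pre1 := encnat n.
Let pre2 := pre1 ++ encnat s.
Let pre3 := pre2 ++ encnat b0.
Let pre4 := pre3 ++ encnat k0.
Let matrix := [seq e i j | i <- enum 'I_n, j <- enum 'I_n].
Let base := (size pre4).+1.
Let M := len * len + len + Lmax + 1.
Let E u v := I1 (base + (u * n + v)).

Let w_eq : w = pre4 ++ matrix.
Proof. by rewrite /w /enc_instance /pre4 /pre3 /pre2 /pre1 -!catA. Qed.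

Let size_matrix : size matrix = n * n.
Proof. by rewrite size_allpairs size_enum_ord. Qed.

Let size_w : size pre4 + n * n = size w.
Proof. by rewrite w_eq size_cat size_matrix. Qed.

Let n_gt0 : 0 < n.
Proof. exact: leq_ltn_trans (leq0n s) (ltn_ord s). Qed.

Let n_lt : n < len.
Proof. by rewrite /len -size_w; move: n_gt0; nia. Qed.

Let EE (i j : 'I_n) : E i j = e i j.
Proof.
rewrite /E /I1 /base addSn /= w_eq nth_cat ltnNge leq_addr /= addKn.
rewrite -{2}(size_enum_ord n) (nth_allpairs _ i j) ?size_enum_ord ?ltn_ord //.
by rewrite !nth_ord_enum.
Qed.

Let b_gt0 : 0 < b. Proof. by rewrite leq_min b0_gt0. Qed.
Let k_gt0 : 0 < k. Proof. by rewrite leq_min k0_gt0. Qed.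

Let run L m := simulate E n s b k (fun i _ => testbit m i) L n.

Let run_coherent L m : coherent E n s k L D (run L m).
Proof. exact: inv_simulate (degree_bound EE) (ltn_ord s) k_gt0 _ _ _. Qed.

Let success L m : ~~ failed (run L m) -> firefighter_yes e s b0 k0.
Proof. by move=> ok; apply: (schedule_correct EE k_gt0 ok); rewrite geq_minr. Qed.

(** A strategy would give a successful sequence of length [maxn L (k * D)]. Its first [L] bits lead
    to a run that is not short of bits, hence to the same run, which would not fail. *)
Let refuted L : (forall m, m < 2 ^ L -> failed (run L m) /\ ~~ short (run L m)) ->
  ~ firefighter_yes e s b0 k0.
Proof.
move=> none_works [strat [valid le_k]].
have [X [sX ball_k sched]] := contains_of_strategy valid le_k.
(* The capped numbers are as good as the given ones, as no set of vertices has more than [len]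
   elements. *)
have cX : contains e s b k X.
  have card_le (A : {set 'I_n}) : #|A| <= len.
    by apply: leq_trans (ltnW n_lt); rewrite -[X in _ <= X]card_ord max_card.
  split=> // t; first by rewrite leq_min card_le ball_k.
  rewrite /b minnMl leq_min sched andbT; apply: leq_trans (card_le _) _.
  by rewrite leq_pmulr.
have [m' lt_m' ok] := decisions_exist EE k_gt0 cX (leqnn k) (leq_maxr L (k * D)).
have lt_m := bits_val_lt L (testbit m').
have [fa sh] := none_works _ lt_m.
have := simulate_enough (degree_bound EE) (ltn_ord s) k_gt0 (leq_maxl L (k * D))
  (d2 := fun i _ => testbit m' i) _ sh => same.
move: fa; rewrite /run same ?(negPf ok) // => i v lt_i.
by rewrite testbit_bits_val lt_i.
Qed.

Let bounded : (exists2 m, m < 2 ^ Lmax & ~~ failed (run Lmax m)) \/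
  forall m, ~~ short (run Lmax m).
Proof.
case: (leqP g k) => [le_g|lt_k].
  have [X cX] := containment s pw; left.
  by apply: (decisions_exist EE k_gt0 (contains_mono b_gt0 (leqnn g) cX)).
right=> m; apply/negP => /(inv_short (run_coherent Lmax m)).
by rewrite ltnNge /Lmax leq_mul2r ltnW ?orbT.
Qed.

Let support L m : [/\ empty_from n (seen (run L m)), empty_from n (active (run L m))
  & empty_from n (pending (run L m))].
Proof.
have I := run_coherent L m.
have small v : v \in val s :: found (run L m) -> ~~ (n <= v).
  by move/(inv_lt I); rewrite -ltnNge.
split=> v le_v; apply/negP => /=.
- by rewrite (inv_seen I) => /small; rewrite le_v.
- by move/(inv_active I)/(inv_burnt I)/small; rewrite le_v.
- by move/(inv_pending I)/(inv_burnt I)/small; rewrite le_v.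
Qed.

Definition main_cost := len * 2 + 4 * parse_cost w +
  2 ^ Lmax.+1 * (round_cost n b Lmax).+1 + 15.

Lemma runs_main : exists2 s',
  exists2 t, t <= main_cost * (8 * M + 30) & exec cMain (input_tracks w) 0 t s' 0 &
  nth none s' 27 0 = false <-> firefighter_yes e s b0 k0.
Proof.
have len_M : len < M by rewrite /M; lia.
have b_le : b <= len by apply: geq_minl.
have k_le : k <= len by apply: geq_minl.
have nb_le : n * b + b <= M.
  have : n.+1 * b <= len * len by apply: leq_mul.
  by rewrite /M; lia.
have base_le : base + n * n <= M by rewrite /M /base /len -size_w; lia.
have n_le : n <= M by lia.
have s_lt := ltn_ord s.
have kM : k <= M by lia.
have Lmax_le : Lmax <= M by rewrite /M; lia.
have n_min : minn len n = n by apply/minn_idPr/ltnW.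
have s_min : minn len s = s by apply/minn_idPr; apply: ltnW; apply: ltn_trans n_lt.
have w1 : w = [::] ++ encnat n ++ (encnat s ++ encnat b0 ++ encnat k0 ++ matrix) by [].
have w2 : w = pre1 ++ encnat s ++ (encnat b0 ++ encnat k0 ++ matrix) by [].
have w3 : w = pre2 ++ encnat b0 ++ (encnat k0 ++ matrix).
  by rewrite w2 /pre2 -catA.
have w4 : w = pre3 ++ encnat k0 ++ matrix by rewrite w3 /pre3 -catA.
have [W1 [X1 [W1_le X1_le parse1]]] := @runs_parse M w len_M 0 0 0 0 0 0 0 0 _ _ _ w1 isT isT isT.
rewrite -/len n_min in W1_le X1_le parse1.
have [W2 [X2 [W2_le X2_le parse2]]] :=
  @runs_parse M w len_M n 0 0 0 0 n W1 X1 _ _ _ w2 (ltnW n_lt) W1_le X1_le.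
rewrite -/len s_min in W2_le X2_le parse2.
have [W3 [X3 [W3_le X3_le parse3]]] :=
  @runs_parse M w len_M n s 0 0 0 s W2 X2 _ _ _ w3 (ltnW (ltn_trans s_lt n_lt)) W2_le X2_le.
rewrite -/len -/b -size_cat -/pre3 in W3_le X3_le parse3.
have [W4 [X4 [W4_le X4_le parse4]]] :=
  @runs_parse M w len_M n s b 0 0 b W3 X3 _ _ _ w4 b_le W3_le X3_le.
rewrite -/len -/k -size_cat -/pre4 -/base in W4_le X4_le parse4.
rewrite -size_cat -/pre2 in parse2.
have empty : empty_from n none by [].
(* The search starts with the empty sequence, [L = 0] and [m = 0], whose number is 1. *)
have [||||s' search ans] := @runs_search M I0 I1 len n s b k base k W4 X4 nb_le kM base_le n_le
  s_lt k_gt0 Lmax _ success refuted bounded support Lmax_le (2 ^ Lmax.+1 - 1) 0 0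
  none none none 0 0 0 false false isT isT isT empty empty empty isT isT.
- by [].
- by [].
- by [].
- by [].
exists s' => //.
rewrite -/I0 -/I1 in parse1 parse2 parse3 parse4.
suff [t] : runs M cMain (input_tracks w) s' main_cost by exists t.
have flag_none : flag false = none.
  by apply: functional_extensionality => x; rewrite /flag; case: eqP.
have zero_none : testbit 0 = none.
  by apply: functional_extensionality => x; rewrite testbit_zero.
apply: (runs_weaken (k := 1 + ((len * 2 + 5) + (parse_cost w + (1 + (parse_cost w + (1 +
  (parse_cost w + (1 + (parse_cost w + (1 + (1 + (1 + (1 +
  ((2 ^ Lmax.+1 - 1) * (round_cost n b Lmax).+1).+1)))))))))))))).
  by rewrite /main_cost mulnBl; lia.
apply: (runs_seq (s1 := memory I0 I1 0 0 0 0 0 0 0 0 0 0 0 none none none 0 0 0 false false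
     0 0 0 none false false 0 0)).
  rewrite /memory flag_none.
  set rs := [:: 3; 4; 5; 6; 7; 8; 9; 10; 11; 12; 13; 17; 18; 19; 22; 23; 24; 28; 29].
  exists (size rs).+1; first by rewrite mul1n; apply: leq_trans (leq_addl _ _).
  by apply: (@exec_init (input_tracks w) rs) => // j; rewrite !inE;
    do ![case/orP => [/eqP-> //|]]; move/eqP->.
apply: runs_seq; first exact: (runs_length len_M).
apply: runs_seq; first exact: parse1.
apply: runs_seq; first by apply: (runs_copy (u := 0) (v := n)).
apply: runs_seq; first exact: parse2.
apply: runs_seq; first by apply: (runs_copy (u := 0) (v := s)) => //=; lia.
apply: runs_seq; first exact: parse3.
apply: runs_seq; first by apply: (runs_copy (u := 0) (v := b)) => //=; lia.
apply: runs_seq; first exact: parse4.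
apply: runs_seq; first by apply: (runs_copy (u := 0) (v := k)) => //=; lia.
apply: runs_seq; first by apply: (runs_copy (u := 0) (v := base)) => //=; lia.
apply: runs_seq; first by apply: (runs_zero (v := base)) => //=; lia.
apply: runs_seq; first exact: (runs_flag (u := false)).
by rewrite zero_none in search.
Qed.
End Instance.

(** * Computing the time bound *)

Definition tower (m x : nat) : nat := iter m (expn 2) x.

Definition cPower : cmd :=
  Seq (Inc 11)
  (Seq (For 13 10 (Seq (Copy 12 11) (For 22 12 (Inc 11))))
  (Seq (Copy 10 11) (Seq (Zero 11) (Zero 12)))).

(** After the iterated power, the input is overwritten from position 1 on by zeros, as many as the
    value of register 10, and a final one, with an empty cell behind. The registers are reset at the
    end because a mark inside the output would change its symbols. *)
Definition cBound : cmd :=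
  Seq (cInit [:: 3; 4; 5; 6; 7; 8; 9; 10; 11; 12; 13; 17; 18; 19; 22; 23; 24; 28; 29])
  (Seq cLength
  (Seq (Copy 10 4) (Seq (Inc 10) (Seq (Inc 10) (Seq cPower (Seq (Copy 5 10)
  (Seq (For 23 5 cPower)
  (Seq (For 13 10 (Seq (Put 0 3 true) (Seq (Put 1 3 false) (Inc 3))))
  (Seq (Put 0 3 false) (Seq (Put 1 3 true) (Seq (Inc 3)
  (Seq (Put 0 3 false) (Seq (Put 1 3 false)
  (Seq (Zero 3) (Seq (Zero 4) (Seq (Zero 5) (Zero 10))))))))))))))))).

Lemma leq_tower m m' x : m <= m' -> tower m x <= tower m' x.
Proof.
move=> /subnK <-; elim: (m' - m) => // d IH.
by rewrite addSn; apply: leq_trans IH _; apply: ltnW; apply: ltn_expl.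
Qed.

Lemma binary_pow2 m : binary (2 ^ m) = rcons (nseq m false) true.
Proof.
suff aux f : 2 ^ m <= f -> bits_aux f (2 ^ m) = rcons (nseq m false) true by apply: aux.
elim: m f => [|m IH] [|f] le_f; rewrite ?leqn0 ?expn_eq0 // in le_f.
  by case: f le_f.
have pos := expn_gt0 2 m; rewrite expnS mul2n /= odd_double double_eq0 -leqn0 leqNgt pos /=.
by rewrite doubleK IH //; rewrite expnS in le_f; lia.
Qed.

Section Bound.
Variables (M : nat) (w : seq bool).
Let I0 : track := fun x => (0 < x <= size w) && ~~ nth false w x.-1.
Let I1 : track := fun x => (0 < x) && nth false w x.-1.
Let len := (size w).+1.
Let N := 2 ^ len.+2.
Let m := tower N N.
Hypothesis M_eq : M = m + len + 10.

Notation memory_b J0 J1 len n V W X pos i t u :=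
  (memory J0 J1 len n 0 0 0 0 V W X pos i none none none 0 0 0 false false
     t u 0 none false false 0 0).
Notation working n V W X i t u := (memory_b I0 I1 len n V W X 1 i t u).

Definition power_cost := M * (M * 3 + 5) + 6.

Lemma runs_power n V u : 2 ^ V <= M ->
  runs M cPower (working n V 0 0 0 0 u) (working n (2 ^ V) 0 0 0 0 u) power_cost.
Proof.
move=> le_M; have V_lt : V < M by apply: leq_trans (ltn_expl V _) le_M.
have pow_le x : x <= V -> 2 ^ x <= 2 ^ V by move=> ?; rewrite leq_exp2l.
apply: (runs_weaken (k := 1 + ((V * (1 + (M * 3).+2).+2).+2 + (1 + (1 + 1))))).
  have := leq_mul V_lt (leqnn (M * 3 + 5)).
  by rewrite /power_cost; lia.
pose st x := working n V (2 ^ x) (if x is x'.+1 then 2 ^ x' else 0) x 0 u.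
pose st' x := working n V (2 ^ x.+1) (2 ^ x) x 0 u.
pose X := if V is V'.+1 then 2 ^ V' else 0.
have X_le : X <= M by rewrite /X; case: (V) pow_le le_M => // V' /(_ _ (leqnSn V')); lia.
apply: (runs_seq (s1 := st 0)); first exact: (runs_inc (v := 0)).
apply: (runs_seq (s1 := working n V (2 ^ V) X 0 0 u)).
  apply: (runs_for (st := st) (st' := st')) => //; first exact: ltnW.
  move=> x lt_x; have := pow_le x (ltnW lt_x); have := pow_le _ lt_x => pxS px.
  have X_le' : (if x is x'.+1 then 2 ^ x' else 0) <= M.
    by case: x {st st'} lt_x pxS px => // x ? _ _; have := pow_le x (ltnW (ltnW _)); lia.
  apply: (runs_seq (s1 := working n V (2 ^ x) (2 ^ x) x 0 u)).
    by apply: (runs_copy (v := 2 ^ x) (u := if x is x'.+1 then 2 ^ x' else 0)) => //; lia.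
  pose st1 y := working n V (2 ^ x + y) (2 ^ x) x y u.
  pose st2 y := working n V (2 ^ x + y).+1 (2 ^ x) x y u.
  have -> : working n V (2 ^ x) (2 ^ x) x 0 u = st1 0 by rewrite /st1 addn0.
  apply: (runs_weaken (k := (2 ^ x * 3).+2)); first lia.
  apply: (runs_for (st := st1) (st' := st2)) => //; first lia.
  - by move=> y; rewrite /st1 addnS.
  - by rewrite /st' expnS mul2n -addnn.
  - move=> y lt_y; apply: (runs_inc (v := 2 ^ x + y)) => //.
    by rewrite expnS in pxS; lia.
apply: runs_seq; first by apply: (runs_copy (u := V) (v := 2 ^ V)) => //; lia.
apply: runs_seq; first by apply: (runs_zero (v := 2 ^ V)).
by apply: (runs_zero (v := X)).
Qed.

Let J0 x : track := fun y => if 0 < y <= x then true else I0 y.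
Let J1 x : track := fun y => if 0 < y <= x then false else I1 y.

(** Computability asks for no time bound, so the number of instructions remains existential. *)
Lemma runs_bound : exists s', [/\ exists k, runs M cBound (input_tracks w) s' k,
  forall i, i < m -> cell s' i.+1 = fun j => j == 0,
  cell s' m.+1 = fun j => j == 1 & cell s' m.+2 = none].
Proof.
pose K0 := set_at (set_at (J0 m) m.+1 false) m.+2 false.
pose K1 := set_at (set_at (J1 m) m.+1 true) m.+2 false.
exists (memory_b K0 K1 0 0 0 0 0 0 0 0 0).
have cellE x : cell (memory_b K0 K1 0 0 0 0 0 0 0 0 0) x.+1 =
    fun j => if j == 0 then K0 x.+1 else if j == 1 then K1 x.+1 else false.
  apply: functional_extensionality => j; rewrite /cell.
  by do 31 (case: j => [|j] //).
have below : forall i, i < m -> (i.+1 == m.+2 = false) * (i.+1 == m.+1 = false).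
  by move=> i lt_i; split; apply/eqP; lia.
split; last 3 first.
- move=> i lt_i; rewrite cellE /K0 /K1 /set_at !below //= /J0 /J1 /= lt_i.
  by apply: functional_extensionality => j; case: eqP => // _; case: eqP.
- rewrite cellE /K0 /K1 /set_at eqxx ltn_eqF //.
  by apply: functional_extensionality => j; case: eqP => [->|_] //; case: eqP.
- rewrite cellE /K0 /K1 /set_at eqxx.
  by apply: functional_extensionality => j; case: eqP => // _; case: eqP.
have len_lt : len < M by lia.
have N_le : N <= m by exact: (leq_tower N (leq0n N)).
have lenN : len.+2 < N by apply: ltn_expl.
have NM : N <= M by lia.
eexists.
apply: (runs_seq (k1 := 1) (s1 := memory I0 I1 0 0 0 0 0 0 0 0 0 0 0 none none none 0 0 0 false false
     0 0 0 none false false 0 0)).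
  have flag_none : flag false = none.
    by apply: functional_extensionality => x; rewrite /flag; case: eqP.
  rewrite /memory flag_none.
  set rs := [:: 3; 4; 5; 6; 7; 8; 9; 10; 11; 12; 13; 17; 18; 19; 22; 23; 24; 28; 29].
  exists (size rs).+1; first by rewrite mul1n; apply: leq_trans (leq_addl _ _).
  by apply: (@exec_init (input_tracks w) rs) => // j; rewrite !inE;
    do ![case/orP => [/eqP-> //|]]; move/eqP->.
apply: runs_seq; first exact: (runs_length len_lt).
apply: runs_seq; first by apply: (runs_copy (u := 0) (v := len)) => //; lia.
apply: runs_seq; first by apply: (runs_inc (v := len)) => //; lia.
apply: runs_seq; first by apply: (runs_inc (v := len.+1)) => //; lia.
apply: runs_seq; first exact: (@runs_power 0 len.+2 0).
apply: (runs_seq (s1 := working N N 0 0 0 0 0)).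
  by apply: (runs_copy (u := 0) (v := N)).
apply: (runs_seq (s1 := working N m 0 0 0 0 0)).
  pose st x := working N (tower x N) 0 0 0 0 x.
  pose st' x := working N (tower x.+1 N) 0 0 0 0 x.
  rewrite -/(st 0); apply: (runs_for (st := st) (st' := st') (N := N)) => //.
  move=> x lt_x; apply: runs_power.
  have le_m : tower x.+1 N <= m by apply: leq_tower.
  by apply: leq_trans le_m _; lia.
apply: (runs_seq (s1 := memory_b (J0 m) (J1 m) len N m 0 0 m.+1 0 0 0)).
  pose st x := memory_b (J0 x) (J1 x) len N m 0 0 x.+1 x 0 0.
  pose st' x := memory_b (J0 x.+1) (J1 x.+1) len N m 0 0 x.+2 x 0 0.
  have -> : working N m 0 0 0 0 0 = st 0.
    rewrite /st; congr memory; apply: functional_extensionality => y;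
    by rewrite /J0 /J1; case: y.
  apply: (runs_for (st := st) (st' := st') (N := m)) => //; first lia.
  move=> x lt_x; have pos_le : x.+1 <= M by lia.
  have J0S : J0 x.+1 = set_at (J0 x) x.+1 true.
    apply: functional_extensionality => y; rewrite /J0 /set_at [y <= x.+1]leq_eqVlt ltnS.
    by case: eqP => // ->.
  have J1S : J1 x.+1 = set_at (J1 x) x.+1 false.
    apply: functional_extensionality => y; rewrite /J1 /set_at [y <= x.+1]leq_eqVlt ltnS.
    by case: eqP => // ->.
  rewrite /st' J0S J1S; apply: (runs_seq (k1 := 1)); first exact: (runs_put (v := x.+1)).
  apply: (runs_seq (k1 := 1)); first exact: (runs_put (v := x.+1)).
  exact: (runs_inc (v := x.+1)).
have pos1 : m.+1 <= M by lia.
have pos2 : m.+2 <= M by lia.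
apply: runs_seq; first exact: (runs_put (v := m.+1)).
apply: runs_seq; first exact: (runs_put (v := m.+1)).
apply: runs_seq; first exact: (runs_inc (v := m.+1)).
apply: runs_seq; first exact: (runs_put (v := m.+2)).
apply: runs_seq; first exact: (runs_put (v := m.+2)).
apply: runs_seq; first exact: (runs_zero (v := m.+2)).
apply: runs_seq; first by apply: (runs_zero (v := len)) => //; lia.
apply: runs_seq; first by apply: (runs_zero (v := N)).
by apply: (runs_zero (v := m)) => //; lia.
Qed.

End Bound.

(* A power of two is easily written in binary from its exponent in unary; and as
   p and d are less than two to the length of their code, it suffices to know
   that length. *)
Definition time_bound (p d : nat) : nat :=
  let N := 2 ^ (size (encnat p ++ encnat d) + 3) in 2 ^ tower N N.

Lemma computable_time_bound : computable2 time_bound.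
Proof.
(* Track 30 is never marked, so the verdict is always to accept; [GoR] places the head at position
   1, where the output begins. *)
exists (machine (maxn 2 (width (Seq cBound GoR))) (program (Seq cBound GoR) 30)) => p d.
set w := encnat p ++ encnat d.
have [s' [[k [t _ ex]] zeros one stop]] := runs_bound (w := w) (erefl _).
have {}ex := ExecSeq ex (ExecR _ _).
have [acc out] := @run_program (Seq cBound GoR) 30 w _ _ _ ex _ (leqnn _).
exists (t + 1).+2; set m := tower _ _ in zeros one stop.
have -> : time_bound p d = 2 ^ m by rewrite /time_bound /m addn3.
rewrite binary_pow2; split; last apply: out.
- rewrite acc; case: (posnP m) => [m0|lt_m]; last by rewrite zeros.
  by rewrite -m0 one.
- move=> i; rewrite size_rcons size_nseq ltnS leq_eqVlt add1n nth_rcons size_nseq nth_nseq.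
  by case: eqP => [->|_] /=; [rewrite ltnn | move=> lt_i; rewrite lt_i; apply: zeros].
- by rewrite size_rcons size_nseq add1n.
Qed.

(** * Estimates for the time bound *)

Lemma bits_nat_lt l : bits_nat l < 2 ^ size l.
Proof. by elim: l => //= c l IH; rewrite expnS; case: c; lia. Qed.

Lemma lt_encnat m : m < 2 ^ size (encnat m).
Proof.
have [_ _ _ ->] := nth_encnat m [::].
rewrite -{1}(bits_nat_binary m); apply: leq_trans (bits_nat_lt _) _.
by rewrite leq_exp2l //; lia.
Qed.

Lemma square_le_pow y : 4 <= y -> y * y <= 2 ^ y.
Proof.
elim: y => // y IH; rewrite leq_eqVlt => /orP[/eqP <- //|lt_y].
by have := IH lt_y; rewrite expnS; nia.
Qed.

(** One step of the recursion for [radius], with [2 ^ l] in place of the bag size and of the degree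
    plus one. The new term is a power of two with exponent below [y * y], and [y * y <= 2 ^ y]; thus
    a round costs two exponentials. The summand [l + 4] is kept so that the estimate can be
    iterated. *)
Lemma tower_step l r y : r + l + 4 <= y ->
  r + (2 * 2 ^ l * (2 ^ l) ^ r.+1).+1 + l + 4 <= tower 2 y.
Proof.
move=> le_y; have y4 : 4 <= y by lia.
have y2 : 0 < y * y by nia.
have : 2 * 2 ^ l * (2 ^ l) ^ r.+1 <= 2 ^ (y * y).-1.
  rewrite -expnM -expnS -expnD leq_exp2l //.
  have := leq_mul (_ : l <= y - 4) (_ : r <= y - 4); rewrite mulnS => /(_ _ _).
  by move=> /(_ ltac:(lia) ltac:(lia)); nia.
have : y.+1 <= 2 ^ (y * y).-1.
  by apply: leq_trans (ltn_expl y (ltnSn 1)) _; rewrite leq_exp2l //; nia.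
have : 2 ^ (y * y) <= tower 2 y by rewrite leq_exp2l // square_le_pow.
by rewrite -{1}(prednK y2) expnS; lia.
Qed.

Lemma tower_big l r D y : 4 <= l -> D < 2 ^ l -> r + l + 4 <= y ->
  3 * (D.+1 ^ r * D).+1 + 15 <= tower 2 y.
Proof.
move=> l4 lt_D le_y; have := tower_step le_y.
have : D.+1 ^ r * D <= 2 ^ l * (2 ^ l) ^ r.
  by rewrite mulnC leq_mul ?(ltnW lt_D) //; case: (r) => // r'; rewrite leq_exp2r.
have : 16 <= 2 ^ l by rewrite (@leq_exp2l 2 4).
have : 0 < (2 ^ l) ^ r by rewrite !expn_gt0.
rewrite !expnS; move: (2 ^ l) ((2 ^ l) ^ r) => A B; nia.
Qed.

Lemma radius_tower n (e : rel 'I_n) l W j : W <= 2 ^ l -> max_degree e < 2 ^ l ->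
  radius e W j + l + 4 <= tower (2 * j) (2 ^ (l + 3)).
Proof.
move=> le_W lt_D; elim: j => [|j IH].
  by rewrite muln0 /= expnD; have := ltn_expl l (ltnSn 1); lia.
rewrite mulnS /tower iterD -/(tower _ _); apply: leq_trans (tower_step IH).
rewrite /= !leq_add2r leq_add2l ltnS leq_mul ?leq_mul2l ?le_W ?orbT //.
by rewrite leq_exp2r.
Qed.

Lemma time_bound_ge p n (e : rel 'I_n) :
  2 ^ (3 * ((max_degree e).+1 ^ radius e p.+1 p.+1 * max_degree e).+1 + 15) <=
  time_bound p (max_degree e).
Proof.
rewrite /time_bound; set D := max_degree e; set l := size _; set N := 2 ^ (l + 3).
have [_ _ _ size_p] := nth_encnat p [::]; have [_ _ _ size_d] := nth_encnat D [::].
have l_eq : l = size (encnat p) + size (encnat D) by rewrite /l size_cat.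
have lt_p : p < 2 ^ l by apply: leq_trans (lt_encnat p) _; rewrite leq_exp2l // l_eq leq_addr.
have lt_D : D < 2 ^ l by apply: leq_trans (lt_encnat D) _; rewrite leq_exp2l // l_eq leq_addl.
rewrite leq_exp2l //.
apply: leq_trans (tower_big _ lt_D (@radius_tower n e l p.+1 p.+1 lt_p lt_D)) _.
  by rewrite l_eq size_p size_d; lia.
have -> : tower 2 (tower (2 * p.+1) N) = tower (2 + 2 * p.+1) N by rewrite /tower iterD.
(* The height [2 * p + 4] is at most [N = 8 * 2 ^ l], because [p < 2 ^ l]. *)
apply: leq_tower.
by rewrite /N expnD; lia.
Qed.

(** With [a = size w] there are, up to constants, [2 ^ Q] rounds of [a ^ 3 * Q] instructions, each
    of [a ^ 2 * Q] steps. By [Q < 2 ^ Q] the product is at most [2 ^ (3 * Q) * a ^ 5], and the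
    constants are absorbed because [345 * 86 < 2 ^ 15]. *)
Lemma main_cost_le n (e : rel 'I_n) (s : 'I_n) b k p :
  let w := enc_instance e s b k in
  let Q := ((max_degree e).+1 ^ radius e p.+1 p.+1 * max_degree e).+1 in
  let M := (size w).+1 * (size w).+1 + (size w).+1 + Q.-1 + 1 in
  (main_cost e s b k p * (8 * M + 30)).+2 <= 2 ^ (3 * Q + 15) * size w ^ 5.
Proof.
cbv zeta; set w := enc_instance _ _ _ _; set a := size w.
set Q := (_ ^ _ * _).+1; set M := _ + _ + _ + 1.
have n_gt0 : 0 < n by apply: leq_ltn_trans (leq0n s) (ltn_ord s).
have n_le : n <= a.
  by rewrite /a /w /enc_instance !size_cat size_allpairs size_enum_ord; nia.
have b_le : minn a.+1 b <= a.+1 by apply: geq_minl.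
rewrite /main_cost /parse_cost /round_cost /layer_cost -/w -/a.
rewrite -/Q (_ : (max_degree e).+1 ^ radius e p.+1 p.+1 * max_degree e = Q.-1) //.
have Q_gt0 : 0 < Q by []; rewrite /M.
move: Q Q_gt0 {M} => Q Q_gt0.
move: (minn _ _) b_le => b' b_le.
have a_gt0 : 0 < a by lia.
have QQ : Q < 2 ^ Q by apply: ltn_expl.
have -> : 2 ^ (3 * Q + 15) = 2 ^ Q * 2 ^ Q * 2 ^ Q * 2 ^ 15.
  by rewrite mulnC expnD expnM !expnS expn0 muln1; lia.
have lc : b' * 3 + n * (n * 16).+4 + n * 5 + 8 + 2 <= 41 * (a * a) by nia.
set LC := b' * 3 + _ + _ + _ in lc *.
set C := a * a * a * Q.
have C1 : a * a * a <= C by rewrite leq_pmulr.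
have C2 : Q <= C by rewrite leq_pmull // !muln_gt0 a_gt0.
have C3 : a <= a * a by rewrite leq_pmulr.
have C4 : a * a <= a * a * a by rewrite leq_pmulr.
have rc : (n * 5 + n * LC.+2 + Q.-1 * 3 + 20).+1 <= 70 * C.
  have : n * LC.+2 <= a * (41 * (a * a)) by apply: leq_mul => //; lia.
  lia.
move: (n * 5 + _ + _ + _).+1 rc => RC rc.
have mc : a.+1 * 2 + 4 * (a.+1 * (a.+1 * 8 + 12) + 8) + 2 ^ Q * RC + 15 <= 345 * (2 ^ Q * C).
  have : 2 ^ Q * RC <= 2 ^ Q * (70 * C) by rewrite leq_mul2l rc orbT.
  have : C <= 2 ^ Q * C by rewrite leq_pmull // expn_gt0.
  have : a.+1 * (a.+1 * 8 + 12) + 8 <= 64 * (a * a) by nia.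
  lia.
move: (a.+1 * 2 + _ + _ + _) mc => MC mc.
have mm : 8 * (a.+1 * a.+1 + a.+1 + Q.-1 + 1) + 30 <= 86 * (a * a * Q).
  have : a * a <= a * a * Q by rewrite leq_pmulr.
  have : Q <= a * a * Q by rewrite leq_pmull // muln_gt0 a_gt0.
  have : a.+1 * a.+1 + a.+1 <= 6 * (a * a) by nia.
  lia.
move: (8 * _ + 30) mm => MM mm.
have prod := leq_mul mc mm.
have -> : 2 ^ Q * 2 ^ Q * 2 ^ Q * 2 ^ 15 * a ^ 5 =
    2 ^ 15 * (2 ^ Q * (a * a * a * 2 ^ Q) * (a * a * 2 ^ Q)).
  by rewrite (_ : a ^ 5 = a * a * a * (a * a)); [lia | rewrite !expnS expn0; lia].
have big : 2 ^ Q * C * (a * a * Q) <= 2 ^ Q * (a * a * a * 2 ^ Q) * (a * a * 2 ^ Q).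
  by rewrite !leq_mul // ltnW.
have pos : 0 < 2 ^ Q * C * (a * a * Q).
  by rewrite !muln_gt0 expn_gt0 a_gt0 Q_gt0.
rewrite mulnACA in prod; move: (2 ^ Q * C * _) prod big pos => U prod big pos.
move: (_ * (_ * _ * _ * _) * _) big => U' big.
by rewrite (_ : 2 ^ 15 = 32 * 1024) //; lia.
Qed.

Theorem theorem4 :
  exists f : nat -> nat -> nat, computable2 f /\
  exists (M : TM) (c : nat),
    forall (n : nat) (e : rel 'I_n) (s : 'I_n) (b k : nat),
      symmetric e -> irreflexive e -> 0 < b -> 0 < k ->
      forall p : nat, is_pathwidth e p ->
        let w := enc_instance e s b k in
        let cfg := run M (f p (max_degree e) * (size w) ^ c) w in
        halted cfg /\ (c_state cfg = q_acc M <-> firefighter_yes e s b k).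
Proof.
exists time_bound; split; first exact: computable_time_bound.
exists (machine (maxn 2 (width cMain)) (program cMain 27)), 5.
move=> n e s b k _ _ b_gt0 k_gt0 p [pw _] w; set T := _ * _ => cfg.
have [s' [t le_t ex] ans] := runs_main s b_gt0 k_gt0 pw.
have le_T : t.+2 <= T.
  apply: leq_trans (leq_trans (main_cost_le e s b k p) _); first by rewrite !ltnS.
  by rewrite leq_mul2r time_bound_ge orbT.
have [st _] := @run_program cMain 27 w _ _ _ ex T le_T.
rewrite -/cfg in st; rewrite /halted st -ans /cell.
by case: (nth none s' 27 0); rewrite eqxx ?orbT; split=> //; split=> // /(congr1 val) /=;
  rewrite !inordK.
Qed.
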